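(* Let $k$ be an algebraically closed field and let $\mathcal{A}$ be a Deligne-finite $k$-linear abelian category. Fix an ordering $S_1,\ldots,S_n$ of (representatives of the isomorphism classes of) its simple objects, and let $P_i$ and $\Delta_i$ be the corresponding projective covers and standard objects. Then $\mathcal{A}$ is highest weight with respect to the given ordering if and only if there is a stability function $Z\colon K(\mathcal{A})\to\mathbb{C}$ on $\mathcal{A}$ such that (a) $\Delta_1,\ldots,\Delta_n$ are $Z$-stable with $\phi(\Delta_1)<\cdots<\phi(\Delta_n)$, and (b) for each $i=1,\ldots,n$, the Harder--Narasimhan factors of $P_i$ are direct sums of standard objects $\Delta_j$ with $j\geq i$.
   Context: A $k$-linear abelian category $\mathcal{A}$ is Deligne finite if it is $\mathrm{Hom}$-finite and $\mathrm{Ext}^1$-finite (these are finite-dimensional over $k$), every object has finite length, it has finitely many simple objects up to isomorphism, and it has enough projectives. (Equivalently, $\mathcal{A}$ is equivalent to the category of finite-dimensional modules over a finite-dimensional $k$-algebra.) For a collection of objects, $\mathrm{Filt}(\ldots)$ denotes its extension-closure, i.e. the full subcategory of objects having a finite filtration whose factors are isomorphic to objects of the collection. Given the ordering $S_1,\ldots,S_n$, set $\mathcal{A}_i=\mathrm{Filt}(S_1,\ldots,S_i)$. Let $P_i$ be a projective cover of $S_i$ in $\mathcal{A}$. The standard object $\Delta_i$ is the maximal quotient of $P_i$ lying in $\mathcal{A}_i$. $\mathcal{A}$ is highest weight with respect to the ordering $S_1,\ldots,S_n$ if $\mathrm{End}_{\mathcal{A}}(\Delta_i)\cong k$ and $P_i\in\mathrm{Filt}(\Delta_i,\ldots,\Delta_n)$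 for each $i=1,\ldots,n$. Let $\mathbb{H}=\{re^{i\pi\phi}\mid r>0,\ \phi\in(0,1]\}\subset\mathbb{C}$. A stability function on $\mathcal{A}$ is a group homomorphism $Z\colon K(\mathcal{A})\to\mathbb{C}$ from the Grothendieck group such that $Z(A):=Z([A])\in\mathbb{H}$ for every nonzero $A\in\mathcal{A}$. The phase $\phi(A)\in(0,1]$ of a nonzero object $A$ is determined by $Z(A)\in\mathbb{R}_{>0}e^{i\pi\phi(A)}$. A nonzero object $A$ is $Z$-semistable if $\phi(A')\leq\phi(A)$ for every nonzero proper subobject $A'\subset A$, and $Z$-stable if the inequality is always strict. Since $\mathcal{A}$ is a length category, every nonzero object $A$ has a unique Harder--Narasimhan filtration $0=A_0\subset A_1\subset\cdots\subset A_d=A$ in which each $A_l/A_{l-1}$ is nonzero and $Z$-semistable of phase $\phi_l$, with $\phi_1>\phi_2>\cdots>\phi_d$; the quotients $A_l/A_{l-1}$ are the Harder--Narasimhan factors of $A$. *)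

(* Defs.v *)
From HB Require Import structures.
From mathcomp Require Import all_boot all_order all_algebra.
From mathcomp Require Import all_classical all_reals all_analysis.
From mathcomp Require Import complex freeg.
From Stdlib Require List.

Set Implicit Arguments.
Unset Strict Implicit.
Unset Printing Implicit Defensive.

Import Order.TTheory GRing.Theory Num.Theory.

Local Open Scope ring_scope.

Record linCategory (k : fieldType) := LinCategory {
  obj :> Type;
  mor : obj -> obj -> lmodType k;
  idmor : forall A, mor A A;
  compmor : forall A B C, mor B C -> mor A B -> mor A C;
  compmor_idl : forall A B (f : mor A B), compmor (idmor B) f = f;
  compmor_idr : forall A B (f : mor A B), compmor f (idmor A) = f;
  compmorA : forall A B C D (h : mor C D) (g : mor B C) (f : mor A B),
    compmor h (compmor g f) = compmor (compmor h g) f;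
  compmor_linl : forall A B C (c : k) (g g' : mor B C) (f : mor A B),
    compmor (c *: g + g') f = c *: compmor g f + compmor g' f;
  compmor_linr : forall A B C (c : k) (g : mor B C) (f f' : mor A B),
    compmor g (c *: f + f') = c *: compmor g f + compmor g f'
}.

Arguments mor {k l} _ _.
Arguments idmor {k l} _.
Arguments compmor {k l A B C} _ _.

Notation "g \oc f" := (compmor g f) (at level 40, left associativity).

Section Categories.
Context {k : fieldType} {C : linCategory k}.
Implicit Types A B D E P Q S X Y : C.

Definition is_mono A B (m : mor A B) :=
  forall X (f g : mor X A), m \oc f = m \oc g -> f = g.

Definition is_epi A B (e : mor A B) :=
  forall X (f g : mor B X), f \oc e = g \oc e -> f = g.

Definition is_iso A B (f : mor A B) :=
  exists g : mor B A, g \oc f = idmor A /\ f \oc g = idmor B.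

Definition isomorphic A B := exists f : mor A B, is_iso f.

Definition is_zero A :=
  (forall X (f : mor X A), f = 0) /\ (forall X (f : mor A X), f = 0).

Definition is_kernel A B D (m : mor A B) (f : mor B D) :=
  f \oc m = 0 /\
  forall X (g : mor X B), f \oc g = 0 -> exists! h : mor X A, m \oc h = g.

Definition is_cokernel A B D (e : mor B D) (f : mor A B) :=
  e \oc f = 0 /\
  forall X (g : mor B X), g \oc f = 0 -> exists! h : mor D X, h \oc e = g.

Definition is_biproduct m (X : 'I_m -> C) D
    (inj : forall i, mor (X i) D) (prj : forall i, mor D (X i)) :=
  [/\ forall i, prj i \oc inj i = idmor (X i),
      forall i j, i != j -> prj j \oc inj i = 0
    & \sum_(i < m) inj i \oc prj i = idmor D].

Definition is_direct_sum m (X : 'I_m -> C) D :=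
  exists inj prj, @is_biproduct m X D inj prj.

Definition short_exact A B D (f : mor A B) (g : mor B D) :=
  is_kernel f g /\ is_cokernel g f.

Definition is_simple S :=
  ~ is_zero S /\ forall X (m : mor X S), is_mono m -> is_zero X \/ is_iso m.

Definition is_projective P :=
  forall X Y (e : mor X Y) (f : mor P Y), is_epi e ->
    exists g : mor P X, e \oc g = f.

Definition is_projective_cover P S (p : mor P S) :=
  [/\ is_projective P, is_epi p
    & forall X (g : mor X P), is_epi (p \oc g) -> is_epi g].

(* [filtered A s]: there are subobjects 0 = A_0, A_1, ..., A_d = A, each
   contained in the next, with quotients A_l / A_(l-1) isomorphic to the members of s, in this order. *)
Inductive filtered : C -> seq C -> Prop :=
| filtered_nil A : is_zero A -> filtered A [::]
| filtered_rcons A' A F s (f : mor A' A) (g : mor A F) :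
    filtered A' s -> short_exact f g -> filtered A (rcons s F).

Definition Filt (X : C -> Prop) A :=
  exists s, filtered A s /\
    List.Forall (fun F => exists G, X G /\ isomorphic F G) s.

Definition finite_length A := exists s, filtered A s /\ List.Forall is_simple s.

Record extension A B := Extension {
  ext_mid : C;
  ext_in : mor B ext_mid;
  ext_out : mor ext_mid A;
  ext_exact : short_exact ext_in ext_out
}.

Definition ext_morphism A A' B B' (a : mor A A') (b : mor B B')
    (E : extension A B) (E' : extension A' B') :=
  exists e : mor (ext_mid E) (ext_mid E'),
    e \oc ext_in E = ext_in E' \oc b /\ ext_out E' \oc e = a \oc ext_out E.

(* The class of E in Ext^1(A, B) is \sum_i c i [G i]. Here F is the pull-back
   along the diagonal A -> A^m of the direct sum of the G i, and E is its
   push-out along the map (c 0, ..., c (m-1)) : B^m -> B; for m = 2 and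
   c = (1, 1) this is the Baer sum, for m = 1 the action of a scalar, and for
   m = 0 it says that E splits. *)
Definition ext_linear_comb A B m (c : 'I_m -> k) (G : 'I_m -> extension A B)
    (E : extension A B) :=
  exists BB inj prj, @is_biproduct m (fun=> B) BB inj prj /\
  exists F : extension A BB,
    (forall i, ext_morphism (idmor A) (prj i) F (G i)) /\
    ext_morphism (idmor A) (\sum_(i < m) c i *: prj i) F E.

End Categories.

(* The empty direct sum provides a zero object. *)
Definition is_abelian (k : fieldType) (C : linCategory k) :=
  [/\ forall m (X : 'I_m -> C), exists D, is_direct_sum X D,
      forall (A B : C) (f : mor A B), exists K (m : mor K A), is_kernel m f,
      forall (A B : C) (f : mor A B), exists K (e : mor B K), is_cokernel e f,
      forall (A B : C) (m : mor A B), is_mono m ->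
        exists D (f : mor B D), is_kernel m f
    & forall (A B : C) (e : mor A B), is_epi e ->
        exists D (f : mor D A), is_cokernel e f].

Definition Hom_finite (k : fieldType) (C : linCategory k) :=
  forall A B : C, exists m (b : 'I_m -> mor A B),
    forall f, exists c : 'I_m -> k, f = \sum_(i < m) c i *: b i.

Definition Ext1_finite (k : fieldType) (C : linCategory k) :=
  forall A B : C, exists m (G : 'I_m -> extension A B),
    forall E, exists c : 'I_m -> k, ext_linear_comb c G E.

Record Deligne_finite (k : fieldType) (C : linCategory k) : Prop := {
  _ : is_abelian C;
  _ : Hom_finite C;
  _ : Ext1_finite C;
  _ : forall A : C, finite_length A;
  _ : exists m (T : 'I_m -> C), forall S : C, is_simple S ->
        exists i, isomorphic S (T i);
  _ : forall A : C, exists (P : C) (e : mor P A), is_projective P /\ is_epi e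
}.

Definition simple_ordering (k : fieldType) (C : linCategory k) n
    (S : 'I_n -> C) :=
  [/\ forall i, is_simple (S i),
      forall i j, isomorphic (S i) (S j) -> i = j
    & forall X : C, is_simple X -> exists i, isomorphic X (S i)].

Definition Filt_le (k : fieldType) (C : linCategory k) n (S : 'I_n -> C)
    (i : 'I_n) : C -> Prop :=
  Filt (fun X => exists2 j : 'I_n, (j <= i)%N & X = S j).

Definition Filt_ge (k : fieldType) (C : linCategory k) n (Delta : 'I_n -> C)
    (i : 'I_n) : C -> Prop :=
  Filt (fun X => exists2 j : 'I_n, (i <= j)%N & X = Delta j).

(* [q] exhibits [D] as the largest quotient of [P] satisfying [X]. *)
Definition is_max_quotient (k : fieldType) (C : linCategory k)
    (X : C -> Prop) (P D : C) (q : mor P D) :=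
  [/\ is_epi q, X D
    & forall (Q : C) (e : mor P Q), is_epi e -> X Q ->
        exists h : mor D Q, h \oc q = e].

Definition End_is_scalar (k : fieldType) (C : linCategory k) (A : C) :=
  exists phi : {linear mor A A -> k^o},
    [/\ bijective phi, phi (idmor A) = 1
      & forall f g, phi (g \oc f) = phi g * phi f].

Definition highest_weight (k : fieldType) (C : linCategory k) n
    (P Delta : 'I_n -> C) :=
  forall i, End_is_scalar (Delta i) /\ Filt_ge Delta i (P i).

Section GrothendieckGroup.
Context {k : fieldType} (C : linCategory k).

(* The subgroup of the free abelian group on the objects generated by the
   elements [B] - [A] - [D] for 0 -> A -> B -> D -> 0 exact. *)
Definition K0_relations : {pred {freeg {classic C}}} := fun x =>
  `[< forall H : {freeg {classic C}} -> Prop,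
        H 0 -> (forall y z, H y -> H z -> H (y - z)) ->
        (forall (A B D : C) (f : mor A B) (g : mor B D), short_exact f g ->
           H (<< (B : {classic C}) >> - << (A : {classic C}) >>
                - << (D : {classic C}) >>)) ->
        H x >].

Lemma K0_relations_zmod_closed : zmod_closed K0_relations.
Proof.
split=> [|x y].
  by rewrite unfold_in; apply/asboolP => H.
rewrite !unfold_in => /asboolP hx /asboolP hy; apply/asboolP => H H0 HB Hex.
exact: (HB _ _ (hx H H0 HB Hex) (hy H H0 HB Hex)).
Qed.

HB.instance Definition _ := GRing.isZmodClosed.Build {freeg {classic C}}
  K0_relations K0_relations_zmod_closed.

Definition K0 : zmodType := Quotient.quot K0_relations.

Definition K0_class (A : C) : K0 :=
  (\pi_(Quotient.quot K0_relations) << (A : {classic C}) >>)%qT.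

End GrothendieckGroup.

Section Stability.
Context {R : realType} {k : fieldType} {C : linCategory k}.

Definition polar (r phi : R) : R[i] :=
  (r * cos (pi * phi) +i* (r * sin (pi * phi)))%C.

Definition has_phase (z : R[i]) (phi : R) :=
  [/\ 0 < phi, phi <= 1 & exists2 r, 0 < r & z = polar r phi].

Definition half_plane (z : R[i]) := exists phi, has_phase z phi.

(* Junk value 0 when z is not in the half plane. *)
Definition cphase (z : R[i]) : R := xget 0 (has_phase z).

Implicit Type Z : {additive K0 C -> R[i]}.

Definition is_stability Z :=
  forall A : C, ~ is_zero A -> half_plane (Z (K0_class A)).

Definition phase Z (A : C) : R := cphase (Z (K0_class A)).

Definition semistable Z (A : C) :=
  ~ is_zero A /\
  forall (A' : C) (m : mor A' A), is_mono m -> ~ is_zero A' -> ~ is_iso m ->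
    phase Z A' <= phase Z A.

Definition stable Z (A : C) :=
  ~ is_zero A /\
  forall (A' : C) (m : mor A' A), is_mono m -> ~ is_zero A' -> ~ is_iso m ->
    phase Z A' < phase Z A.

(* [s] lists the factors of a Harder-Narasimhan filtration of [A]; this
   filtration is unique, so [s] is unique up to termwise isomorphism. *)
Definition HN_factors Z (A : C) (s : seq C) :=
  [/\ filtered A s, List.Forall (semistable Z) s
    & sorted (fun x y : R => y < x) [seq phase Z F | F <- s]].

Definition sum_of_ge n (Delta : 'I_n -> C) (i : 'I_n) (F : C) :=
  exists m (J : 'I_m -> 'I_n),
    (forall l, (i <= J l)%N) /\ is_direct_sum (fun l => Delta (J l)) F.

End Stability.

(* Main.v *)
(* Generalized elements P -> X with P projective allow diagram chases, and
   dim Hom(P_i, X) is the multiplicity of S_i in X; in particular Filt(S_1, ..., S_i)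
   consists of the X with Hom(P_j, X) = 0 for all j > i.

   If A is highest weight, then Delta_i contains S_i exactly once and all its other
   factors are S_j with j < i. Let Z(S_i) = -b^i + sqrt(-1) with b larger than the
   length of every Delta_j. The factor S_i then dominates, so Delta_i has larger phase
   than every object whose factors are S_j with j < i: this gives stability and the
   order of the phases. Delta_i is projective relative to Filt(S_1, ..., S_i), whence
   Ext^1(Delta_i, Delta_j) = 0 for j <= i, and a filtration of P_i by standard objects
   can be rearranged into one whose layers are sums of equal Delta_j with j
   decreasing: the Harder-Narasimhan filtration.

   Conversely, Schur's lemma for stable objects gives End(Delta_i) = k, and refining
   the Harder-Narasimhan filtration of P_i gives the filtration by standard objects. *)

Require Import Defs.
From HB Require Import structures.
From mathcomp Require Import generic_quotient ring_quotient freeg.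
From mathcomp Require Import all_boot all_order all_algebra.
From mathcomp Require Import all_classical all_reals all_analysis.
From mathcomp Require Import complex ring lra.

Set Implicit Arguments.
Unset Strict Implicit.
Unset Printing Implicit Defensive.

Import Order.TTheory GRing.Theory Num.Theory.

Local Open Scope ring_scope.

(** * Abelian categories *)

Section LinearCategory.
Context {k : fieldType} {C : linCategory k}.
Implicit Types A B D E X Y : C.

Lemma compDl A B D (g g' : mor B D) (f : mor A B) :
  (g + g') \oc f = g \oc f + g' \oc f.
Proof. by rewrite -[g]scale1r compmor_linl !scale1r. Qed.

Lemma compDr A B D (g : mor B D) (f f' : mor A B) :
  g \oc (f + f') = g \oc f + g \oc f'.
Proof. by rewrite -[f]scale1r compmor_linr !scale1r. Qed.

Lemma comp0l A B D (f : mor A B) : (0 : mor B D) \oc f = 0.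
Proof. by apply: (addrI (0 \oc f)); rewrite -compDl !addr0. Qed.

Lemma comp0r A B D (g : mor B D) : g \oc (0 : mor A B) = 0.
Proof. by apply: (addrI (g \oc 0)); rewrite -compDr !addr0. Qed.

Lemma compZl A B D c (g : mor B D) (f : mor A B) :
  (c *: g) \oc f = c *: (g \oc f).
Proof. by rewrite -[c *: g]addr0 compmor_linl comp0l addr0. Qed.

Lemma compZr A B D c (g : mor B D) (f : mor A B) :
  g \oc (c *: f) = c *: (g \oc f).
Proof. by rewrite -[c *: f]addr0 compmor_linr comp0r addr0. Qed.

Lemma compNl A B D (g : mor B D) (f : mor A B) : (- g) \oc f = - (g \oc f).
Proof. by rewrite -scaleN1r compZl scaleN1r. Qed.

Lemma compNr A B D (g : mor B D) (f : mor A B) : g \oc (- f) = - (g \oc f).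
Proof. by rewrite -scaleN1r compZr scaleN1r. Qed.

Lemma compBl A B D (g g' : mor B D) (f : mor A B) :
  (g - g') \oc f = g \oc f - g' \oc f.
Proof. by rewrite compDl compNl. Qed.

Lemma compBr A B D (g : mor B D) (f f' : mor A B) :
  g \oc (f - f') = g \oc f - g \oc f'.
Proof. by rewrite compDr compNr. Qed.

Lemma comp_suml A B D (I : Type) (r : seq I) (g : I -> mor B D) (f : mor A B) :
  (\sum_(i <- r) g i) \oc f = \sum_(i <- r) g i \oc f.
Proof.
by elim: r => [|i r IH]; rewrite ?big_nil ?comp0l // !big_cons compDl IH.
Qed.

Lemma comp_sumr A B D (I : Type) (r : seq I) (g : mor B D) (f : I -> mor A B) :
  g \oc (\sum_(i <- r) f i) = \sum_(i <- r) g \oc f i.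
Proof.
by elim: r => [|i r IH]; rewrite ?big_nil ?comp0r // !big_cons compDr IH.
Qed.

Lemma is_monoP A B (m : mor A B) :
  is_mono m <-> forall X (f : mor X A), m \oc f = 0 -> f = 0.
Proof.
split=> [hm X f mf|hm X f g mfg]; first by apply: hm; rewrite mf comp0r.
by apply/eqP; rewrite -subr_eq0; apply/eqP/hm; rewrite compBr mfg subrr.
Qed.

Lemma is_epiP A B (e : mor A B) :
  is_epi e <-> forall X (f : mor B X), f \oc e = 0 -> f = 0.
Proof.
split=> [he X f fe|he X f g feg]; first by apply: he; rewrite fe comp0l.
by apply/eqP; rewrite -subr_eq0; apply/eqP/he; rewrite compBl feg subrr.
Qed.

Lemma mono_comp A B D (g : mor B D) (f : mor A B) :
  is_mono g -> is_mono f -> is_mono (g \oc f).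
Proof. by move=> hg hf X u v; rewrite -!compmorA => /hg /hf. Qed.

Lemma epi_comp A B D (g : mor B D) (f : mor A B) :
  is_epi g -> is_epi f -> is_epi (g \oc f).
Proof. by move=> hg hf X u v; rewrite !compmorA => /hf /hg. Qed.

Lemma mono_compr A B D (g : mor B D) (f : mor A B) :
  is_mono (g \oc f) -> is_mono f.
Proof. by move=> h X u v fuv; apply: h; rewrite -!compmorA fuv. Qed.

Lemma epi_compl A B D (g : mor B D) (f : mor A B) :
  is_epi (g \oc f) -> is_epi g.
Proof. by move=> h X u v fuv; apply: h; rewrite !compmorA fuv. Qed.

Lemma split_mono A B (m : mor A B) (r : mor B A) : r \oc m = idmor A -> is_mono m.
Proof.
by move=> rm X u v /(congr1 (compmor r)); rewrite !compmorA rm !compmor_idl.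
Qed.

Lemma split_epi A B (e : mor A B) (s : mor B A) : e \oc s = idmor B -> is_epi e.
Proof.
move=> es X u v /(congr1 (fun h => h \oc s)).
by rewrite -!compmorA es !compmor_idr.
Qed.

Lemma iso_mono A B (f : mor A B) : is_iso f -> is_mono f.
Proof. by case=> g [gf _]; apply: split_mono gf. Qed.

Lemma iso_epi A B (f : mor A B) : is_iso f -> is_epi f.
Proof. by case=> g [_ fg]; apply: split_epi fg. Qed.

Lemma isomorphic_sym A B : isomorphic A B -> isomorphic B A.
Proof. by case=> f [g [gf fg]]; exists g, f. Qed.

Lemma isomorphic_refl A : isomorphic A A.
Proof. by exists (idmor A), (idmor A); rewrite compmor_idl. Qed.

Lemma is_zeroP A : is_zero A <-> idmor A = 0.
Proof.
split=> [[h _]|h]; first exact: h.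
split=> X f; first by rewrite -[f]compmor_idl h comp0l.
by rewrite -[f]compmor_idr h comp0r.
Qed.

Lemma mono_zero A B (m : mor A B) : is_mono m -> is_zero B -> is_zero A.
Proof.
by move=> /is_monoP hm [hB _]; apply/is_zeroP/hm; rewrite compmor_idr.
Qed.

Lemma epi_zero A B (e : mor A B) : is_epi e -> is_zero A -> is_zero B.
Proof.
by move=> /is_epiP he [_ hA]; apply/is_zeroP/he; rewrite compmor_idl.
Qed.

Lemma isomorphic_zero A B : isomorphic A B -> is_zero A -> is_zero B.
Proof. by case=> f /iso_epi/epi_zero. Qed.

Lemma kernel_mono A B D (m : mor A B) (f : mor B D) : is_kernel m f -> is_mono m.
Proof.
case=> fm hm X u v muv.
have [|w [_ uw]] := hm _ (m \oc u); first by rewrite compmorA fm comp0l.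
by rewrite -(uw u) // -(uw v).
Qed.

Lemma cokernel_epi A B D (e : mor B D) (f : mor A B) : is_cokernel e f -> is_epi e.
Proof.
case=> ef he X u v uv.
have [|w [_ uw]] := he _ (u \oc e); first by rewrite -compmorA ef comp0r.
by rewrite -(uw u) // -(uw v).
Qed.

Lemma kernel_lift A B D (m : mor A B) (f : mor B D) X (g : mor X B) :
  is_kernel m f -> f \oc g = 0 -> exists h, m \oc h = g.
Proof. by case=> _ hm /hm [h [mh _]]; exists h. Qed.

Lemma cokernel_lift A B D (e : mor B D) (f : mor A B) X (g : mor B X) :
  is_cokernel e f -> g \oc f = 0 -> exists h, h \oc e = g.
Proof. by case=> _ he /he [h [eh _]]; exists h. Qed.

Lemma is_kernelP A B D (m : mor A B) (f : mor B D) :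
  is_kernel m f <-> [/\ is_mono m, f \oc m = 0
    & forall X (g : mor X B), f \oc g = 0 -> exists h, m \oc h = g].
Proof.
split=> [hk|[hm fm hk]]; first split.
- exact: kernel_mono hk.
- by case: hk.
- by move=> X g; apply: kernel_lift.
split=> // X g /hk [h mh]; exists h; split=> // h' mh'.
by apply: hm; rewrite mh mh'.
Qed.

Lemma is_cokernelP A B D (e : mor B D) (f : mor A B) :
  is_cokernel e f <-> [/\ is_epi e, e \oc f = 0
    & forall X (g : mor B X), g \oc f = 0 -> exists h, h \oc e = g].
Proof.
split=> [hk|[hm fm hk]]; first split.
- exact: cokernel_epi hk.
- by case: hk.
- by move=> X g; apply: cokernel_lift.
split=> // X g /hk [h mh]; exists h; split=> // h' mh'.
by apply: hm; rewrite mh mh'.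
Qed.

Lemma short_exact_mono A B D (f : mor A B) (g : mor B D) :
  short_exact f g -> is_mono f.
Proof. by case=> /kernel_mono. Qed.

Lemma short_exact_epi A B D (f : mor A B) (g : mor B D) :
  short_exact f g -> is_epi g.
Proof. by case=> _ /cokernel_epi. Qed.

Lemma short_exact_comp0 A B D (f : mor A B) (g : mor B D) :
  short_exact f g -> g \oc f = 0.
Proof. by case=> [[]]. Qed.

Lemma short_exact_lift A B D (f : mor A B) (g : mor B D) X (u : mor X B) :
  short_exact f g -> g \oc u = 0 -> exists h, f \oc h = u.
Proof. by case=> /kernel_lift h _; apply: h. Qed.

Lemma short_exact_retraction A B D (f : mor A B) (g : mor B D) (s : mor D B) :
  short_exact f g -> g \oc s = idmor D -> exists r, r \oc f = idmor A.
Proof.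
move=> fg gs.
have [|r fr] := @short_exact_lift _ _ _ f g _ (idmor B - s \oc g) fg.
  by rewrite compBr compmor_idr compmorA gs compmor_idl subrr.
exists r; apply: (short_exact_mono fg).
rewrite compmorA fr compBl compmor_idl -compmorA (short_exact_comp0 fg).
by rewrite comp0r subr0 compmor_idr.
Qed.

Lemma short_exact_iso A A' B (f : mor A A') :
  is_iso f -> is_zero B -> short_exact f (0 : mor A' B).
Proof.
move=> [g [gf fg]] zB; split.
  apply/is_kernelP; split=> [||X u _]; first exact: split_mono gf.
    exact: comp0l.
  by exists (g \oc u); rewrite compmorA fg compmor_idl.
apply/is_cokernelP; split=> [||X u uf].
  by move=> Y v w _; rewrite (proj2 zB _ v) (proj2 zB _ w).
  exact: comp0l.
exists 0; rewrite comp0r; symmetry.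
by rewrite -[u]compmor_idr -fg compmorA uf comp0l.
Qed.

Lemma short_exact_zero_id A B (f : mor A B) :
  is_zero A -> short_exact f (idmor B).
Proof.
move=> zA; have f0 : f = 0 by exact: (proj2 zA).
split.
  apply/is_kernelP; split=> [||X u].
    by move=> Y v w _; rewrite (proj1 zA _ v) (proj1 zA _ w).
    by rewrite compmor_idl.
  by rewrite compmor_idl => ->; exists 0; rewrite comp0r.
apply/is_cokernelP; split=> [||X u _]; last by exists u; rewrite compmor_idr.
  by apply: (@split_epi _ _ _ (idmor B)); rewrite compmor_idl.
by rewrite compmor_idl.
Qed.

End LinearCategory.

(** * Kernels, cokernels and images in an abelian category *)

Section Abelian.
Context {k : fieldType} {C : linCategory k} (abC : is_abelian C).
Implicit Types A B D E X Y : C.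

(** [m] is a kernel of some [f], and [f] factors through [e]; so whatever [e] kills is killed by [f]
    and lifts through [m]. *)
Lemma mono_cokernel A B D (m : mor A B) (e : mor B D) :
  is_mono m -> is_cokernel e m -> short_exact m e.
Proof.
case: abC => _ _ _ hmono _ hm he; split=> //.
have [F [f /is_kernelP[_ fm hf]]] := hmono _ _ _ hm.
have [r re] := cokernel_lift he fm.
apply/is_kernelP; split=> [//||X g eg]; first by case: he.
by apply: hf; rewrite -re -compmorA eg comp0r.
Qed.

Lemma epi_kernel A B D (m : mor A B) (e : mor B D) :
  is_epi e -> is_kernel m e -> short_exact m e.
Proof.
case: abC => _ _ _ _ hepi he hm; split=> //.
have [F [f /is_cokernelP[_ ef hf]]] := hepi _ _ _ he.
have [r mr] := kernel_lift hm ef.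
apply/is_cokernelP; split=> [//||X g gm]; first by case: hm.
by apply: hf; rewrite -mr compmorA gm comp0l.
Qed.

Lemma mono_short_exact A B (m : mor A B) :
  is_mono m -> exists D (e : mor B D), short_exact m e.
Proof.
move=> hm; have [_ _ /(_ _ _ m) [D [e he]] _ _] := abC.
by exists D, e; apply: mono_cokernel.
Qed.

Lemma epi_short_exact A B (e : mor A B) :
  is_epi e -> exists D (m : mor D A), short_exact m e.
Proof.
move=> he; have [_ /(_ _ _ e) [D [m hm]] _ _ _] := abC.
by exists D, m; apply: epi_kernel.
Qed.

Lemma mono_epi_iso A B (f : mor A B) : is_mono f -> is_epi f -> is_iso f.
Proof.
move=> hm he; have [D [e fe]] := mono_short_exact hm.
have e0 : e = 0 by move/is_epiP: he; apply; exact: short_exact_comp0 fe.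
have [|g fg] := @short_exact_lift _ _ _ _ _ _ _ _ (idmor B) fe.
  by rewrite e0 comp0l.
exists g; split=> //; apply: hm.
by rewrite compmorA fg compmor_idl compmor_idr.
Qed.

Lemma mono_kernel0 A B K (f : mor A B) (m : mor K A) :
  is_kernel m f -> is_zero K -> is_mono f.
Proof.
move=> hm zK; apply/is_monoP => X u fu.
by have [v <-] := kernel_lift hm fu; rewrite (proj1 zK _ v) comp0r.
Qed.

Lemma image_factorization A B (f : mor A B) :
  exists I (e : mor A I) (m : mor I B), [/\ is_epi e, is_mono m & f = m \oc e].
Proof.
have [_ hker hcok _ hepi] := abC.
have [K [x hx]] := hker _ _ f; have [I [e he]] := hcok _ _ x.
have [m me] := cokernel_lift he (proj1 hx).
have epie := cokernel_epi he.
(* Here [I] is the coimage. If [m \oc u = 0], let [c] be a cokernel of [u]. The epi [c \oc e] is the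
   cokernel of some [h], and [f] kills [h] since [m] factors through [c]. Hence [e] kills [h], so
   [e] factors through [c \oc e]; thus [c] is split mono and [u = 0]. *)
exists I, e, m; split=> //; apply/is_monoP => X u mu.
have [Q [c hc]] := hcok _ _ u; have [m' m'c] := cokernel_lift hc mu.
have ce_epi : is_epi (c \oc e) by apply: epi_comp => //; exact: cokernel_epi hc.
have [H [h hh]] := hepi _ _ _ ce_epi.
have [|t xt] := @kernel_lift _ _ _ _ _ _ _ _ h hx.
  by rewrite -me -m'c -!compmorA (compmorA c) (proj1 hh) comp0r.
have [|r rce] := @cokernel_lift _ _ _ _ _ _ _ _ e hh.
  by rewrite -xt compmorA (proj1 he) comp0l.
have rc : r \oc c = idmor I.
  by apply: epie; rewrite -compmorA rce compmor_idl.
by rewrite -[u]compmor_idl -rc -compmorA (proj1 hc) comp0r.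
Qed.

Lemma binary_biproduct A B : exists D (i1 : mor A D) (i2 : mor B D)
    (p1 : mor D A) (p2 : mor D B),
  [/\ p1 \oc i1 = idmor A, p2 \oc i2 = idmor B, p2 \oc i1 = 0, p1 \oc i2 = 0
    & i1 \oc p1 + i2 \oc p2 = idmor D].
Proof.
have [/(_ 2%N (fun i => if i == ord0 then A else B)) hbip _ _ _ _] := abC.
have [D [inj [prj [h1 h0 hs]]]] := hbip.
pose o1 : 'I_2 := lift ord0 ord0.
exists D, (inj ord0), (inj o1), (prj ord0), (prj o1); split.
- exact: (h1 ord0).
- exact: (h1 o1).
- exact: (h0 ord0 o1).
- exact: (h0 o1 ord0).
- by rewrite -hs !big_ord_recl big_ord0 addr0.
Qed.

Lemma simple_zero_or_mono A B (f : mor A B) : is_simple A -> f = 0 \/ is_mono f.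
Proof.
move=> [_ sA]; have [_ /(_ _ _ f) [K [m hm]] _ _ _] := abC.
case: (sA _ m (kernel_mono hm)) => [zK|/iso_epi/is_epiP hm'].
  by right; apply: mono_kernel0 hm zK.
by left; apply: hm'; case: hm.
Qed.

Lemma simple_zero_or_epi A B (f : mor A B) : is_simple B -> f = 0 \/ is_epi f.
Proof.
move=> [_ sB]; have [I [e [m [he hm ->]]]] := image_factorization f.
case: (sB _ m hm) => [zI|/iso_epi hm']; last by right; apply: epi_comp.
by left; rewrite (proj1 zI _ e) comp0r.
Qed.

End Abelian.

(** * Exact sequences and filtrations *)

Lemma Forall_cat (T : Type) (Q : T -> Prop) (s t : seq T) :
  List.Forall Q (s ++ t) <-> List.Forall Q s /\ List.Forall Q t.
Proof.
elim: s => [|x s [IH1 IH2]] /=; first by split=> [h|[]].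
split=> [h|[hs ht]].
  by inversion h; subst; have [] := IH1 H2; split=> //; constructor.
by inversion hs; subst; constructor=> //; apply: IH2.
Qed.

Lemma Forall_rcons (T : Type) (Q : T -> Prop) (s : seq T) x :
  List.Forall Q (rcons s x) <-> List.Forall Q s /\ Q x.
Proof.
rewrite -cats1 Forall_cat; split=> [[hs hx]|[hs hx]]; last by do !constructor.
by inversion hx.
Qed.

Lemma Forall_all (T : Type) (a : pred T) (s : seq T) :
  List.Forall (fun x => a x) s -> all a s.
Proof. by elim=> //= x t -> _ ->. Qed.

Section ShortExact.
Context {k : fieldType} {C : linCategory k}.
Implicit Types A B D E F X Y : C.

Lemma short_exact_iso_mid A B B' D (f : mor A B) (g : mor B D)
    (h : mor B B') (h' : mor B' B) :
  h' \oc h = idmor B -> h \oc h' = idmor B' ->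
  short_exact f g -> short_exact (h \oc f) (g \oc h').
Proof.
move=> h'h hh' [/is_kernelP[mf gf kf] /is_cokernelP[eg _ cg]]; split.
  apply/is_kernelP; split=> [||X u].
  - by apply: mono_comp => //; apply: split_mono h'h.
  - by rewrite -compmorA (compmorA h') h'h compmor_idl.
  - rewrite -compmorA => /kf[v fv]; exists v.
    by rewrite -compmorA fv compmorA hh' compmor_idl.
apply/is_cokernelP; split=> [||X u].
- by apply: epi_comp => //; apply: split_epi h'h.
- by rewrite -compmorA (compmorA h') h'h compmor_idl.
- rewrite compmorA => /cg[v fv]; exists v.
  by rewrite compmorA fv -compmorA hh' compmor_idr.
Qed.

Lemma short_exact_iso_quo A B D D' (f : mor A B) (g : mor B D) (h : mor D D') :
  is_iso h -> short_exact f g -> short_exact f (h \oc g).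
Proof.
move=> [h' [h'h hh']] [/is_kernelP[mf gf kf] /is_cokernelP[eg _ cg]].
split.
  apply/is_kernelP; split=> [//||X u hgu]; first by rewrite -compmorA gf comp0r.
  apply: kf; rewrite -[g]compmor_idl -h'h -(compmorA h' h).
  by rewrite -(compmorA h') hgu comp0r.
apply/is_cokernelP; split=> [||X u /cg[v <-]].
- by apply: epi_comp => //; apply: split_epi hh'.
- by rewrite -compmorA gf comp0r.
- by exists (v \oc h'); rewrite compmorA -(compmorA v) h'h compmor_idr.
Qed.

Lemma filtered_iso A B s : isomorphic A B -> filtered A s -> filtered B s.
Proof.
move=> [h [h' [h'h hh']]] fA.
case: A s / fA h h' h'h hh' => [A zA|A' A F s f g fA' fg] h h' h'h hh'.
  by constructor; apply: isomorphic_zero zA; exists h, h'.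
by apply: filtered_rcons fA' (short_exact_iso_mid h'h hh' fg).
Qed.

Lemma direct_sum0_zero (X : 'I_0 -> C) D : is_direct_sum X D -> is_zero D.
Proof. by move=> [inj [prj [_ _ h]]]; apply/is_zeroP; rewrite -h big_ord0. Qed.

Lemma direct_sum1 A : is_direct_sum (fun _ : 'I_1 => A) A.
Proof.
exists (fun=> idmor A), (fun=> idmor A).
by split=> [i|i j|]; rewrite ?big_ord1 ?compmor_idl // !ord1.
Qed.

Lemma direct_sum_nonzero m A D :
  is_direct_sum (fun _ : 'I_m.+1 => A) D -> ~ is_zero A -> ~ is_zero D.
Proof.
move=> [inj [prj [h1 _ _]]] nzA zD; apply: nzA.
exact: mono_zero (split_mono (h1 ord0)) zD.
Qed.

Lemma direct_sum_const_rcons m A D D' (i1 : mor D D') (i2 : mor A D')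
    (p1 : mor D' D) (p2 : mor D' A) :
    p1 \oc i1 = idmor D -> p2 \oc i2 = idmor A ->
    p2 \oc i1 = 0 -> p1 \oc i2 = 0 ->
    i1 \oc p1 + i2 \oc p2 = idmor D' ->
  is_direct_sum (fun _ : 'I_m => A) D -> is_direct_sum (fun _ : 'I_m.+1 => A) D'.
Proof.
move=> h11 h22 h21 h12 hs [inj [prj [inj1 inj0 injs]]].
exists (fun i => if unlift ord_max i is Some i' then i1 \oc inj i' else i2).
exists (fun i => if unlift ord_max i is Some i' then prj i' \oc p1 else p2).
split=> [i|i j|].
- case: unliftP => [i' _|_ //].
  by rewrite -compmorA (compmorA p1) h11 compmor_idl.
- case: (unliftP ord_max i) => [i'|] ->; case: (unliftP ord_max j) => [j'|] ->.
  + rewrite (inj_eq lift_inj) => /inj0 h.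
    by rewrite -compmorA (compmorA p1) h11 compmor_idl.
  + by rewrite compmorA h21 comp0l.
  + by rewrite -compmorA h12 comp0r.
  + by rewrite eqxx.
- rewrite (bigD1_ord ord_max) //= unlift_none addrC -hs; congr (_ + _).
  under eq_bigr => i _ do rewrite liftK -compmorA (compmorA (inj i)).
  by rewrite -comp_sumr -comp_suml injs compmor_idl.
Qed.

End ShortExact.

(** * Diagram chases with projective generalized elements *)

Section EnoughProjectives.
Context {k : fieldType} {C : linCategory k} (abC : is_abelian C).
Hypothesis projC :
  forall A : C, exists (P : C) (e : mor P A), is_projective P /\ is_epi e.
Implicit Types A B D E F X Y : C.

Lemma epi_by_projectives A B (e : mor A B) :
  (forall Q (y : mor Q B), is_projective Q -> exists x, e \oc x = y) -> is_epi e.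
Proof.
move=> he; have [Q [y [projQ epiy]]] := projC B.
by have [x ex] := he _ y projQ; apply: (@epi_compl _ _ _ _ _ e x); rewrite ex.
Qed.

(** Cover the source of an arbitrary [h] killed by [g] by a projective: the composite lifts through
    [f], so a cokernel of [f] kills [h]. *)
Lemma short_exact_by_projectives A B D (f : mor A B) (g : mor B D) :
  is_mono f -> is_epi g -> g \oc f = 0 ->
  (forall Q (y : mor Q B), is_projective Q -> g \oc y = 0 ->
     exists x, f \oc x = y) ->
  short_exact f g.
Proof.
move=> mf eg gf exact_mid; apply: epi_kernel => //.
apply/is_kernelP; split=> // X h gh.
have [E [e fe]] := mono_short_exact abC mf.
apply: (short_exact_lift fe); have [Q [y [projQ /is_epiP epiy]]] := projC X.
have [|x fx] := exact_mid _ (h \oc y) projQ; first by rewrite compmorA gh comp0l.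
by apply: epiy; rewrite -compmorA -fx compmorA (short_exact_comp0 fe) comp0l.
Qed.

(** [E] is the pushout of [i] and [e], built as the cokernel of [u] = (-e, i) from [A'] to the
    biproduct of [D] and [A]. *)
Lemma pushout_short_exact A' A Q D (i : mor A' A) (g : mor A Q) (e : mor A' D) :
  short_exact i g -> exists E (j : mor D E) (t : mor E Q) (h : mor A E),
    [/\ short_exact j t, h \oc i = j \oc e & t \oc h = g].
Proof.
move=> ig; have gi0 := short_exact_comp0 ig.
have [S [i1 [i2 [p1 [p2 [h11 h22 h21 h12 hs]]]]]] := binary_biproduct abC D A.
pose u := i2 \oc i - i1 \oc e.
have p2u : p2 \oc u = i.
  by rewrite compBr !compmorA h22 h21 comp0l subr0 compmor_idl.
have mono_u : is_mono u.
  by apply: (@mono_compr _ _ _ _ _ p2); rewrite p2u; apply: short_exact_mono ig.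
have [E [c uc]] := mono_short_exact abC mono_u.
have cu0 := short_exact_comp0 uc.
have [|t tc] := @cokernel_lift _ _ _ _ _ _ _ _ (g \oc p2) (proj2 uc).
  by rewrite -compmorA p2u.
have th : t \oc (c \oc i2) = g by rewrite compmorA tc -compmorA h22 compmor_idr.
exists E, (c \oc i1), t, (c \oc i2); split=> //; last first.
  by apply/eqP; rewrite -!compmorA -subr_eq0 -compBr cu0.
apply: short_exact_by_projectives.
- apply/is_monoP => X x; rewrite -compmorA => /(short_exact_lift uc)[y uy].
  have y0 : y = 0.
    apply: (proj1 (is_monoP i) (short_exact_mono ig)).
    by rewrite -p2u -compmorA uy compmorA h21 comp0l.
  by rewrite -[x]compmor_idl -h11 -compmorA -uy y0 !comp0r.
- apply: (@epi_compl _ _ _ _ _ t (c \oc i2)); rewrite th.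
  exact: short_exact_epi ig.
- by rewrite compmorA tc -compmorA h21 comp0r.
- move=> X y projX ty.
  (* Lift [y] to the biproduct and subtract an element of the image of [u] to remove the
     [A]-component; what is left comes from [D]. *)
  have [z cz] := projX _ _ c y (short_exact_epi uc).
  have [|w iw] := @short_exact_lift _ _ _ _ _ _ _ _ (p2 \oc z) ig.
    by rewrite compmorA -tc -compmorA cz.
  exists (p1 \oc (z - u \oc w)).
  have p2z : p2 \oc (z - u \oc w) = 0 by rewrite compBr compmorA p2u iw subrr.
  have i1p1 : i1 \oc (p1 \oc (z - u \oc w)) = z - u \oc w.
    rewrite compmorA -[RHS]compmor_idl -hs compDl -(compmorA i2) p2z.
    by rewrite comp0r addr0.
  by rewrite -compmorA i1p1 compBr compmorA cu0 comp0l subr0.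
Qed.

(** This is the exactness of Hom(A, D) -> Hom(A', D) -> Ext^1(Q, D) when the last group vanishes:
    the pushout along [e] splits, and a retraction extends [e]. *)
Lemma extend_along_mono A' A Q D (i : mor A' A) (g : mor A Q) (e : mor A' D) :
  short_exact i g ->
  (forall E (j : mor D E) (t : mor E Q), short_exact j t ->
     exists s, t \oc s = idmor Q) ->
  exists f : mor A D, f \oc i = e.
Proof.
move=> ig split_ext.
have [E [j [t [h [jt hi th]]]]] := pushout_short_exact e ig.
have [s ts] := split_ext _ _ _ jt.
have [r rj] := short_exact_retraction jt ts.
by exists (r \oc h); rewrite -compmorA hi compmorA rj compmor_idl.
Qed.

(** [B] is the preimage of [F'] under [g], obtained as the kernel of [g2 \oc g]. *)
Lemma preimage_short_exact A' A F F' G (f : mor A' A) (g : mor A F)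
    (f2 : mor F' F) (g2 : mor F G) :
  short_exact f g -> short_exact f2 g2 ->
  exists B (a : mor A' B) (b : mor B F') (c : mor B A),
    short_exact a b /\ short_exact c (g2 \oc g).
Proof.
move=> fg fg2.
have [_ /(_ _ _ (g2 \oc g)) [B [c hc]] _ _ _] := abC.
have cg : short_exact c (g2 \oc g).
  apply: epi_kernel => //.
  exact: epi_comp (short_exact_epi fg2) (short_exact_epi fg).
have [|a ca] := @short_exact_lift _ _ _ _ _ _ _ _ f cg.
  by rewrite -compmorA (short_exact_comp0 fg) comp0r.
have [|b f2b] := @short_exact_lift _ _ _ _ _ _ _ _ (g \oc c) fg2.
  by rewrite compmorA (short_exact_comp0 cg).
exists B, a, b, c; split=> //; apply: short_exact_by_projectives.
- by apply: (@mono_compr _ _ _ _ _ c); rewrite ca; apply: short_exact_mono fg.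
- apply: epi_by_projectives => Q y projQ.
  have [x gx] := projQ _ _ g (f2 \oc y) (short_exact_epi fg).
  have [|z cz] := @short_exact_lift _ _ _ _ _ _ _ _ x cg.
    by rewrite -compmorA gx compmorA (short_exact_comp0 fg2) comp0l.
  exists z; apply: (short_exact_mono fg2).
  by rewrite compmorA f2b -compmorA cz gx.
- apply: (short_exact_mono fg2).
  by rewrite compmorA f2b -compmorA ca (short_exact_comp0 fg) comp0r.
- move=> Q y _ byy; have [|w fw] := @short_exact_lift _ _ _ _ _ _ _ _ (c \oc y) fg.
    by rewrite compmorA -f2b -compmorA byy comp0r.
  by exists w; apply: (short_exact_mono cg); rewrite compmorA ca.
Qed.

(** Induction on the filtration of [F], whose steps are replaced by their preimages in [A]. *)
Lemma filtered_cat A' A F (f : mor A' A) (g : mor A F) s t :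
  filtered A' s -> filtered F t -> short_exact f g -> filtered A (s ++ t).
Proof.
move=> fA' fF; elim: F t / fF A f g => [F zF|F' F G t f2 g2 _ IH fg2] A f g fg.
  rewrite cats0; apply: filtered_iso fA'; exists f; apply: mono_epi_iso => //.
    exact: short_exact_mono fg.
  apply/is_epiP => X u uf; have [v <-] := cokernel_lift (proj2 fg) uf.
  by rewrite (proj2 zF _ v) comp0l.
have [B [a [b [c [ab cg]]]]] := preimage_short_exact fg fg2.
by rewrite -rcons_cat; apply: filtered_rcons (IH _ _ _ ab) cg.
Qed.

(** The kernel of the last projection is a direct sum of the other objects. *)
Lemma direct_sum_filtered m (X : 'I_m -> C) D : is_direct_sum X D ->
  exists s, filtered D s /\ List.Forall (fun F => exists i, F = X i) s.
Proof.
elim: m => [|m IH] in X D *.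
  by move=> /direct_sum0_zero zD; exists [::]; split=> //; apply: filtered_nil.
move=> [inj [prj [inj1 inj0 injs]]]; pose l := @lift m.+1 ord_max.
have [_ /(_ _ _ (prj ord_max)) [K [c hc]] _ _ _] := abC.
have cp : short_exact c (prj ord_max).
  by apply: epi_kernel => //; apply: split_epi (inj1 ord_max).
have /fin_all_exists [inj' c_inj] i : exists h, c \oc h = inj (l i).
  by apply: short_exact_lift cp _; apply: inj0; rewrite eq_sym neq_lift.
have [|s [fs Fs]] := IH (X \o l) K.
  exists inj', (fun i => prj (l i) \oc c); split=> [i|i j ij|].
  - by rewrite -compmorA c_inj inj1.
  - by rewrite -compmorA c_inj inj0 // (inj_eq lift_inj).
  - apply: (short_exact_mono cp); rewrite comp_sumr compmor_idr.
    under eq_bigr => i _ do rewrite !compmorA c_inj.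
    rewrite -comp_suml -[RHS]compmor_idl -injs (bigD1_ord ord_max) //=.
    by rewrite compDl -(compmorA (inj ord_max)) (short_exact_comp0 cp) comp0r add0r.
exists (rcons s (X ord_max)); split; first exact: filtered_rcons fs cp.
apply/Forall_rcons; split; last by exists ord_max.
by apply: List.Forall_impl Fs => F [i ->]; exists (l i).
Qed.

End EnoughProjectives.

(** * Dimensions of Hom spaces *)

Section Dimension.
Context {k : fieldType}.

Definition spanning (V : lmodType k) m (b : 'I_m -> V) :=
  forall v, exists c : 'I_m -> k, v = \sum_(i < m) c i *: b i.

Definition lin_indep (V : lmodType k) m (b : 'I_m -> V) :=
  forall c : 'I_m -> k, \sum_(i < m) c i *: b i = 0 -> forall i, c i = 0.

Definition basis (V : lmodType k) m (b : 'I_m -> V) := spanning b /\ lin_indep b.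

Definition finite_dim (V : lmodType k) := exists m (b : 'I_m -> V), spanning b.

(* Junk value 0 for infinite-dimensional modules. *)
Definition vdim (V : lmodType k) : nat :=
  xget 0%N [set m | exists b : 'I_m -> V, basis b]%classic.

Implicit Type V : lmodType k.

Lemma finite_dim_basis V : finite_dim V -> exists m (b : 'I_m -> V), basis b.
Proof.
case=> m; elim: m => [|m IH] [b bV].
  by exists 0%N, b; split=> // c _ [].
have [|/existsNP[c /not_implyP[c0 /existsNP[j /eqP cj]]]] :=
  EM (lin_indep b); first by exists m.+1, b.
apply: IH; exists (b \o lift j) => v.
have bj : b j = \sum_(i < m) (- (c j)^-1 * c (lift j i)) *: b (lift j i).
  move: c0; rewrite (bigD1_ord j) //= => /(congr1 (fun u => (c j)^-1 *: u)).
  rewrite scaler0 scalerDr scalerA mulVf // scale1r => /eqP.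
  rewrite addr_eq0 => /eqP ->; rewrite scaler_sumr -sumrN.
  by apply: eq_bigr => i _; rewrite scalerA mulNr scaleNr.
have [a ->] := bV v.
exists (fun i => a (lift j i) - a j * (c j)^-1 * c (lift j i)).
rewrite (bigD1_ord j) //= bj scaler_sumr -big_split /=; apply: eq_bigr => i _.
by rewrite scalerA -scalerDl addrC mulNr mulrN mulrA.
Qed.

(** If [n < m], the [m] by [n] coefficient matrix has a nonzero left kernel, which gives a
    nontrivial relation among the [b i]. *)
Lemma indep_le_spanning V m n (b : 'I_m -> V) (b' : 'I_n -> V) :
  lin_indep b -> spanning b' -> (m <= n)%N.
Proof.
move=> bI b'V; rewrite leqNgt; apply/negP => ltnm.
have /fin_all_exists[a ba] i := b'V (b i).
pose M := \matrix_(i < m, j < n) a i j.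
have: kermx M != 0.
  rewrite kermx_eq0 -row_leq_rank -ltnNge.
  exact: leq_ltn_trans (rank_leq_col M) ltnm.
move=> /rowV0Pn[u /sub_kermxP uM /rV0Pn[j]].
apply/negP; rewrite negbK; apply/eqP; apply: (bI (u 0)).
under eq_bigr => i _ do rewrite ba scaler_sumr.
rewrite exchange_big big1 //= => l _.
under eq_bigr => i _ do rewrite scalerA.
rewrite -scaler_suml.
have := congr1 (fun N : 'rV_n => N 0 l) uM; rewrite !mxE => uMl.
by under eq_bigr => i _ do [rewrite (_ : a i l = M i l); last by rewrite mxE];
  rewrite uMl scale0r.
Qed.

Lemma vdim_basis V : finite_dim V -> exists b : 'I_(vdim V) -> V, basis b.
Proof.
move=> /finite_dim_basis[m bm]; rewrite /vdim.
by case: xgetP => [_ -> //|/(_ m)].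
Qed.

Lemma vdimE V m (b : 'I_m -> V) : basis b -> vdim V = m.
Proof.
move=> [bV bI]; have [|b' [b'V b'I]] := @vdim_basis V; first by exists m, b.
by apply/eqP; rewrite eqn_leq (indep_le_spanning b'I bV) (indep_le_spanning bI b'V).
Qed.

Lemma vdim_gt0 V : finite_dim V -> (0 < vdim V)%N <-> exists v : V, v <> 0.
Proof.
move=> /vdim_basis [b [bV bI]]; split=> [h|[v v0]].
  exists (b (Ordinal h)) => b0.
  have := bI (fun i => (i == Ordinal h)%:R).
  rewrite (bigD1 (Ordinal h)) //= b0 scaler0 add0r big1; last first.
    by move=> i /negbTE ->; rewrite scale0r.
  by move=> /(_ erefl (Ordinal h))/eqP; rewrite eqxx oner_eq0.
rewrite lt0n; apply/eqP => V0; apply: v0.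
have [c ->] := bV v; apply: big1 => -[i hi] _.
by exfalso; rewrite V0 in hi.
Qed.

End Dimension.

(** * Additivity of dim Hom(Q, -) for projective Q *)

Section HomDimension.
Context {k : fieldType} {C : linCategory k} (finHom : Hom_finite C).
Implicit Types A B D Q : C.

(** Projectivity lifts a basis of Hom(Q, D) to Hom(Q, B); together with the image of a basis of
    Hom(Q, A) it is a basis. *)
Lemma vdim_hom_short_exact Q A B D (f : mor A B) (g : mor B D) :
  is_projective Q -> short_exact f g ->
  vdim (mor Q B) = (vdim (mor Q A) + vdim (mor Q D))%N.
Proof.
move=> projQ fg.
have [a [aV aI]] := vdim_basis (finHom Q A).
have [d [dV dI]] := vdim_basis (finHom Q D).
have /fin_all_exists[e ge] j := projQ _ _ g (d j) (short_exact_epi fg).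
pose b i := match fintype.split i with inl i => f \oc a i | inr j => e j end.
have bl i : b (lshift _ i) = f \oc a i by rewrite /b (unsplitK (inl i)).
have br j : b (rshift _ j) = e j by rewrite /b (unsplitK (inr j)).
apply: (@vdimE _ _ _ b); split=> [v|c].
  have [c gv] := dV (g \oc v).
  have [|u fu] := @short_exact_lift _ _ _ _ _ _ _ _ (v - \sum_j c j *: e j) fg.
    rewrite compBr gv comp_sumr; apply/eqP; rewrite subr_eq0; apply/eqP.
    by apply: eq_bigr => j _; rewrite compZr ge.
  have [c' u_c'] := aV u.
  exists (fun i => match fintype.split i with inl i => c' i | inr j => c j end).
  rewrite big_split_ord /=.
  under eq_bigr => i _ do rewrite (unsplitK (inl i)) bl.
  under [X in _ + X]eq_bigr => j _ do rewrite (unsplitK (inr j)) br.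
  apply/eqP; rewrite -subr_eq -fu u_c' comp_sumr; apply/eqP/eq_bigr => i _.
  by rewrite compZr.
rewrite big_split_ord /=.
under eq_bigr => i _ do rewrite bl.
under [X in _ + X]eq_bigr => j _ do rewrite br.
move=> c0; have cr j : c (rshift _ j) = 0.
  apply: (dI (fun j => c (rshift _ j))).
  have := congr1 (compmor g) c0; rewrite comp0r compDr !comp_sumr big1 ?add0r.
    by move=> gc0; rewrite -[RHS]gc0; apply: eq_bigr => l _; rewrite compZr ge.
  by move=> i _; rewrite compZr compmorA (short_exact_comp0 fg) comp0l scaler0.
have cl i : c (lshift _ i) = 0.
  apply: (aI (fun i => c (lshift _ i))).
  apply: (proj1 (is_monoP f) (short_exact_mono fg)).
  rewrite comp_sumr -[RHS]c0 [X in _ + X]big1 ?addr0.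
    by apply: eq_bigr => l _; rewrite compZr.
  by move=> j _; rewrite cr scale0r.
by move=> i; case: (fintype.splitP i) => j ij; [rewrite -(cl j) | rewrite -(cr j)];
  congr c; apply: val_inj.
Qed.

End HomDimension.

(** * Stability functions and phases *)

Section GrothendieckGroupMaps.
Context {k : fieldType} {C : linCategory k}.

Let piK0 (x : {freeg {classic C}}) : K0 C :=
  (\pi_(Quotient.quot (@K0_relations k C)) x)%qT.

Let piK0B x y : piK0 (x - y) = piK0 x - piK0 y.
Proof. exact: pi_is_zmod_morphism. Qed.

Lemma K0_class_short_exact (A B D : C) (f : mor A B) (g : mor B D) :
  short_exact f g -> K0_class B = K0_class A + K0_class D.
Proof.
move=> fg; have pi00 : piK0 0 = 0 by rewrite -[X in piK0 X](subrr 0) piK0B subrr.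
apply/eqP; rewrite -subr_eq0 opprD addrA -[K0_class B]/(piK0 _).
rewrite -[K0_class A]/(piK0 _) -[K0_class D]/(piK0 _) -!piK0B -pi00.
rewrite -Quotient.idealrBE subr0 unfold_in.
by apply/asboolP => H _ _ /(_ _ _ _ _ _ fg).
Qed.

Section Universal.
Context {V : zmodType} (phi : C -> V).
Hypothesis phi_exact : forall (A B D : C) (f : mor A B) (g : mor B D),
  short_exact f g -> phi B = phi A + phi D.

Let F : {freeg {classic C}} -> V :=
  freeg.fglift (phi : {classic C} -> zmodule V).

Let FB x y : F (x - y) = F x - F y.
Proof. exact: (@freeg.lift_is_additive int {classic C} (zmodule V)). Qed.

Let FU (A : C) : F (freeg.Freeg [:: (1, A : {classic C})]) = phi A.
Proof. by rewrite /F freeg.liftU scale1r. Qed.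

Let F_relations x : x \in @K0_relations k C -> F x = 0.
Proof.
rewrite unfold_in => /asboolP/(_ (fun y => F y = 0)) h.
apply: h => [|y z Fy Fz|A B D f g fg].
- by rewrite -[X in F X](subrr 0) FB subrr.
- by rewrite FB Fy Fz subrr.
- by rewrite !FB !FU (phi_exact fg) addrAC addrK subrr.
Qed.

(** The value is taken at the representative chosen by [repr]; [F_relations] makes it independent of
    that choice. *)
Definition K0_fun (u : K0 C) : V := F (repr u).

Let K0_fun_pi x : K0_fun (piK0 x) = F x.
Proof.
apply/eqP; rewrite -subr_eq0 -FB; apply/eqP/F_relations.
by rewrite Quotient.idealrBE reprK.
Qed.

Lemma K0_fun_zmod_morphism : zmod_morphism K0_fun.
Proof.
move=> u v; rewrite -[u]reprK -[v]reprK -piK0B !K0_fun_pi.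
exact: FB.
Qed.

Lemma K0_universal : exists Z : {additive K0 C -> V},
  forall A, Z (K0_class A) = phi A.
Proof.
pose Z : {additive K0 C -> V} := HB.pack K0_fun
  (GRing.isZmodMorphism.Build _ _ K0_fun K0_fun_zmod_morphism).
by exists Z => A; rewrite /= K0_fun_pi FU.
Qed.

End Universal.
End GrothendieckGroupMaps.

(** * Comparing phases by the sign of a determinant *)

Section Phases.
Context {R : realType}.
Implicit Types (z w : R[i]) (phi psi x y : R).

(* For z = r e^(i pi phi) and w = s e^(i pi psi) this is r s sin (pi (phi - psi)). *)
Definition cross z w : R :=
  complex.Im z * complex.Re w - complex.Re z * complex.Im w.

Lemma crossDl z z' w : cross (z + z') w = cross z w + cross z' w.
Proof. by case: z z' => a b [c d]; rewrite /cross /=; ring. Qed.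

Lemma cross_polar z w phi psi : has_phase z phi -> has_phase w psi ->
  exists2 r, 0 < r & cross z w = r * sin (pi * (phi - psi)).
Proof.
move=> [_ _ [r r0 ->]] [_ _ [s s0 ->]]; exists (r * s); first exact: mulr_gt0.
by rewrite /cross /polar /= mulrBr sinB; ring.
Qed.

Lemma sin_pi_gt0 x : 0 < x < 1 -> 0 < sin (pi * x).
Proof.
move=> /andP[x0 x1]; apply: sin_gt0_pi.
by rewrite mulr_gt0 ?pi_gt0 //= -[ltRHS]mulr1 ltr_pM2l ?pi_gt0.
Qed.

(** Both phases lie in (0, 1], so their difference lies in (-1, 1), where sin (pi x) has the sign of
    x. *)
Lemma has_phase_cross z w phi psi : has_phase z phi -> has_phase w psi ->
  (phi < psi) = (cross z w < 0).
Proof.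
move=> hz hw; have [r r0 ->] := cross_polar hz hw.
case: hz hw => z0 z1 _ [w0 w1 _]; rewrite pmulr_rlt0 //.
case: (ltgtP phi psi) => h; last by rewrite h subrr mulr0 sin0 ltxx.
  rewrite -opprB mulrN sinN oppr_lt0 sin_pi_gt0 //; lra.
apply/esym/negbTE; rewrite -leNgt ltW // sin_pi_gt0 //; lra.
Qed.

Lemma cphaseP z : half_plane z -> has_phase z (cphase z).
Proof. by move=> hz; rewrite /cphase; apply: (xgetPex 0 hz). Qed.

Lemma cphase_lt z w : half_plane z -> half_plane w ->
  (cphase z < cphase w) = (cross z w < 0).
Proof. by move=> /cphaseP hz /cphaseP hw; apply: has_phase_cross. Qed.

Lemma cphase_le z w : half_plane z -> half_plane w ->
  (cphase z <= cphase w) = (cross z w <= 0).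
Proof.
move=> hz hw; rewrite leNgt cphase_lt // -leNgt.
have -> : cross w z = - cross z w by rewrite /cross; ring.
by rewrite oppr_ge0.
Qed.

(** The phase is acos (x / r) / pi with [r] the modulus; positivity of [y] selects the root sin
    (acos (x / r)) = y / r. *)
Lemma half_plane_Im_gt0 x y : 0 < y -> half_plane (x +i* y)%C.
Proof.
move=> y0; pose r := Num.sqrt (x ^+ 2 + y ^+ 2).
have r2 : r ^+ 2 = x ^+ 2 + y ^+ 2 by rewrite sqr_sqrtr // addr_ge0 // sqr_ge0.
have y2 : 0 < y ^+ 2 by rewrite exprn_gt0.
have r0 : 0 < r by rewrite sqrtr_gt0 ltr_wpDl // sqr_ge0.
have c2 : (x / r) ^+ 2 + (y / r) ^+ 2 = 1.
  by rewrite !expr_div_n -mulrDl -r2 divff // expf_neq0 // gt_eqF.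
have s0 : 0 < y / r by rewrite divr_gt0.
have c1 : -1 < x / r < 1 by apply/andP; split; nra.
have [c1l c1r] := andP c1.
exists (acos (x / r) / pi); split.
- by rewrite divr_gt0 ?pi_gt0 // acos_gt0 // ltW.
- by rewrite ler_pdivrMr ?pi_gt0 // mul1r acos_lepi // !ltW.
- have piK t : pi * (t / pi) = t :> R by rewrite mulrC mulfVK ?gt_eqF ?pi_gt0.
  have rK t : r * (t / r) = t by rewrite mulrC mulfVK ?gt_eqF.
  exists r => //; rewrite /polar piK acosK ?in_itv /= ?(ltW c1l) ?(ltW c1r) //.
  rewrite sin_acos ?(ltW c1l) ?(ltW c1r) //.
  have -> : 1 - (x / r) ^+ 2 = (y / r) ^+ 2 by rewrite -c2 addrC addKr.
  by rewrite sqrtr_sqr gtr0_norm // !rK.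
Qed.

End Phases.

(** * Standard objects *)

Section Standard.
Context {k : fieldType} {C : linCategory k} (finC : Deligne_finite C).
Context {n : nat} {S : 'I_n -> C} (ordS : simple_ordering S).
Context {P : 'I_n -> C} {p : forall i, mor (P i) (S i)}.
Hypothesis coverP : forall i, is_projective_cover (p i).
Implicit Types (X Y : C) (i j : 'I_n).

Lemma Deligne_abelian : is_abelian C. Proof. by case: finC. Qed.

Lemma Deligne_Hom_finite : Hom_finite C. Proof. by case: finC. Qed.

Lemma Deligne_enough_projectives :
  forall A : C, exists (Q : C) (e : mor Q A), is_projective Q /\ is_epi e.
Proof. by case: finC. Qed.

Lemma simple_filtration X : exists s, filtered X s /\
  List.Forall (fun F => exists i, isomorphic (S i) F) s.
Proof.
case: finC => _ _ _ /(_ X)[s [fX sX]] _ _; exists s; split=> //.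
apply: List.Forall_impl sX => F sF; have [_ _ /(_ F sF)[i h]] := ordS.
by exists i; apply: isomorphic_sym.
Qed.

Let abC := Deligne_abelian.

Lemma cover_projective i : is_projective (P i).
Proof. by case: (coverP i). Qed.

Lemma cover_lift i X Y (e : mor X Y) :
  is_epi e -> forall f : mor (P i) Y, exists g, e \oc g = f.
Proof. by move=> ee f; apply: cover_projective. Qed.

Lemma cover_hom_nonzero i X : isomorphic (S i) X ->
  exists f : mor (P i) X, f <> 0.
Proof.
case=> h isoh; have [_ ep _] := coverP i; have [/(_ i)[nz _] _ _] := ordS.
exists (h \oc p i) => hp0; apply: nz.
apply: mono_zero (iso_mono isoh) _; apply/is_zeroP.
move: (epi_comp (iso_epi isoh) ep); rewrite hp0 => /is_epiP; apply.
by rewrite comp0r.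
Qed.

(** A nonzero [f] is epi. Were [p i] nonzero on its kernel, minimality of the cover would make the
    kernel inclusion epi and [f] zero. So [p i] factors through [f], by an isomorphism of simple
    objects. *)
Lemma cover_hom_simple i j (f : mor (P i) (S j)) : f <> 0 -> i = j.
Proof.
have [simpS uniqS _] := ordS; have [_ ep minp] := coverP i.
have [//|ef f0] := simple_zero_or_epi abC f (simpS j).
have [K [c cf]] := epi_short_exact abC ef.
have [pc0|/minp/is_epiP ec] := simple_zero_or_epi abC (p i \oc c) (simpS i);
  last by case: f0; apply: ec; exact: short_exact_comp0 cf.
have [r rf] := cokernel_lift (proj2 cf) pc0.
have er : is_epi r by apply: (@epi_compl _ _ _ _ _ r f); rewrite rf.
have [r0|mr] := simple_zero_or_mono abC r (simpS j); last first.
  symmetry; apply: uniqS; exists r; exact: mono_epi_iso.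
case: (proj1 (simpS i)); apply/is_zeroP.
by move/is_epiP: er; apply; rewrite r0 comp0r.
Qed.

Lemma nonzero_cover_hom X : ~ is_zero X -> exists i (f : mor (P i) X), f <> 0.
Proof.
have [s [fX]] := simple_filtration X.
case: X s / fX => [//|A' A F s f g _ fg].
move=> /Forall_rcons[_ [i /cover_hom_nonzero[u u0]]] _.
have [v gv] := cover_lift (short_exact_epi fg) u.
by exists i, v => v0; apply: u0; rewrite -gv v0 comp0r.
Qed.

(* The Serre subcategory Filt(S_1, ..., S_i), described by the vanishing of the
   multiplicities of S_j for j > i. *)
Definition supported i X := forall j, (i < j)%N -> forall f : mor (P j) X, f = 0.

Lemma supported_mono i X Y (m : mor X Y) :
  is_mono m -> supported i Y -> supported i X.
Proof. by move=> /is_monoP mm sY j ij f; apply/mm/sY. Qed.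

Lemma supported_epi i X Y (e : mor X Y) :
  is_epi e -> supported i X -> supported i Y.
Proof.
move=> ee sX j ij f; have [g <-] := cover_lift ee f.
by rewrite (sX j ij g) comp0r.
Qed.

Lemma supported_ext i X Y D (f : mor X D) (g : mor D Y) :
  short_exact f g -> supported i X -> supported i Y -> supported i D.
Proof.
move=> fg sX sY j ij u; have [v <-] := short_exact_lift fg (sY j ij (g \oc u)).
by rewrite (sX j ij v) comp0r.
Qed.

Lemma supported_le i j X : (i <= j)%N -> supported i X -> supported j X.
Proof. by move=> ij sX l jl; apply: sX; exact: leq_ltn_trans jl. Qed.

Lemma supported_zero i X : is_zero X -> supported i X.
Proof. by move=> zX j _ f; apply: (proj1 zX). Qed.

Lemma filtered_supported i X s :
  filtered X s -> List.Forall (supported i) s -> supported i X.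
Proof.
elim=> {X s} [A zA _|A' A F s f g _ IH fg /Forall_rcons[/IH sA' sF]].
  exact: supported_zero.
exact: supported_ext fg sA' sF.
Qed.

Lemma supported_filtered i X s :
  filtered X s -> supported i X -> List.Forall (supported i) s.
Proof.
elim=> {X s} [//|A' A F s f g _ IH fg sA]; apply/Forall_rcons; split.
  exact: IH (supported_mono (short_exact_mono fg) sA).
exact: supported_epi (short_exact_epi fg) sA.
Qed.

(** Left to right, Hom(P_l, S_j) = 0 for l different from j. Conversely, a composition factor S_j
    with j > i would receive a nonzero map from P_j. *)
Lemma Filt_leP i X : Filt_le S i X <-> supported i X.
Proof.
split=> [[s [fX sX]]|sX].
  apply: filtered_supported fX _; apply: List.Forall_impl sX.
  move=> F [_ [[j ji ->] [h /iso_mono mh]]]; apply: supported_mono mh _ => l il f.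
  apply: contrapT => /cover_hom_simple lj.
  by move: il; rewrite lj ltnNge ji.
have [s [fX simp]] := simple_filtration X; exists s; split=> //.
have := supported_filtered fX sX; move: simp; elim: s {fX} => [//|F s IH] h1 h2.
inversion h1 as [|? ? [j SjF] h1']; inversion h2 as [|? ? sF h2']; subst.
constructor; last exact: IH.
exists (S j); split; last exact: isomorphic_sym.
exists j => //; rewrite leqNgt; apply/negP => ij.
by have [f] := cover_hom_nonzero SjF; rewrite (sF _ ij f).
Qed.

(** * Relative projectivity of the standard objects *)

Context {Delta : 'I_n -> C} {q : forall i, mor (P i) (Delta i)}.
Hypothesis stdDelta : forall i, is_max_quotient (Filt_le S i) (q i).

Lemma std_supported i : supported i (Delta i).
Proof. by case: (stdDelta i) => _ /Filt_leP. Qed.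

Lemma std_epi i : is_epi (q i).
Proof. by case: (stdDelta i). Qed.

(** The image of [g] is a quotient of [P i] and, as a subobject of [X], is supported; maximality of
    [Delta i] applies to it. *)
Lemma std_hom_factor i X (g : mor (P i) X) : supported i X ->
  exists h : mor (Delta i) X, h \oc q i = g.
Proof.
move=> sX; have [I [e [m [ee mm ->]]]] := image_factorization abC g.
have [_ _ /(_ I e ee)[|h hq]] := stdDelta i.
  by apply/Filt_leP; apply: supported_mono mm sX.
by exists (m \oc h); rewrite -compmorA hq.
Qed.

Lemma std_nonzero i : ~ is_zero (Delta i).
Proof.
move=> zD; have [simpS _ _] := ordS; apply: (proj1 (simpS i)).
have [_ ep _] := coverP i.
have [|h hq] := @std_hom_factor i (S i) (p i).
  move=> j ij f; apply: contrapT => /cover_hom_simple ji.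
  by move: ij; rewrite ji ltnn.
by apply: epi_zero zD; apply: (@epi_compl _ _ _ _ _ h (q i)); rewrite hq.
Qed.

Lemma std_map_nonzero i : q i <> 0.
Proof.
move=> q0; apply: (@std_nonzero i); apply/is_zeroP.
by move/is_epiP: (@std_epi i); apply; rewrite q0 comp0r.
Qed.

(** This is Ext^1(Delta_i, D) = 0: [q i] lifts to [E] by projectivity of [P i], and the lift factors
    through [Delta i] because [E] is again supported. *)
Lemma std_ext_split i D E (f : mor D E) (g : mor E (Delta i)) :
  short_exact f g -> supported i D -> exists s, g \oc s = idmor (Delta i).
Proof.
move=> fg sD; have [u gu] := cover_lift (short_exact_epi fg) (q i).
have [s sq] := std_hom_factor u (supported_ext fg sD (@std_supported i)).
by exists s; apply: (@std_epi i); rewrite -compmorA sq gu compmor_idl.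
Qed.


(** * Rearranging filtrations by standard objects *)

Let projC := Deligne_enough_projectives.

(* Filtrations with factors Delta_l^m, for strictly decreasing l >= b from the
   bottom to the top. *)
Inductive layered : nat -> C -> Prop :=
| layered_zero (b : nat) A : is_zero A -> layered b A
| layered_step (b : nat) (l : 'I_n) m A' A D (f : mor A' A) (g : mor A D) :
    (b <= l)%N -> layered l.+1 A' -> short_exact f g ->
    is_direct_sum (fun _ : 'I_m.+1 => Delta l) D -> layered b A.

Lemma std_sum_supported (l : 'I_n) m D :
  is_direct_sum (fun _ : 'I_m => Delta l) D -> supported l D.
Proof.
move=> /(direct_sum_filtered abC)[s [fD sD]].
apply: (filtered_supported fD); apply: List.Forall_impl sD => F [_ ->].
exact: std_supported.
Qed.

(* Since Ext^1(Delta_l, Delta_l') vanishes for l' <= l, a new top factor Delta_l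
   moves down past all the layers Delta_l' with l' < l. *)
Lemma layered_insert (b : nat) A' A (l : 'I_n) (i : mor A' A) (g : mor A (Delta l)) :
  layered b A' -> short_exact i g -> (b <= l)%N -> layered b A.
Proof.
move=> lay; elim: lay A l i g => {b A'}
  [b A' zA'|b l' m A'' A' D x e bl' lay'' IH xe sumD] A l i g ig bl.
  apply: layered_step bl _ ig (direct_sum1 _). exact: layered_zero.
(* If l < l', the new factor already belongs on top. *)
have [ltl|lel] := ltnP l l'.
  apply: layered_step bl _ ig (direct_sum1 _).
  exact: layered_step ltl lay'' xe sumD.
have sD : supported l D by exact: supported_le lel (std_sum_supported sumD).
(* Now l' <= l, so extensions of Delta_l by [D] split, and the projection [e] of [A'] onto its top
   layer extends to [f] on [A]. *)
have [f fi] := extend_along_mono abC projC e ig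
  (fun E u v uv => std_ext_split uv sD).
have epie := short_exact_epi xe.
have epig := short_exact_epi ig.
have gi0 := short_exact_comp0 ig; have ex0 := short_exact_comp0 xe.
have mono_ix : is_mono (i \oc x).
  by apply: mono_comp; [apply: short_exact_mono ig | apply: short_exact_mono xe].
have ker_fg Q (z : mor Q A) : f \oc z = 0 -> g \oc z = 0 ->
    exists v, i \oc x \oc v = z.
  move=> fz gz; have [w iw] := short_exact_lift ig gz.
  have [|v xv] := @short_exact_lift _ _ _ _ _ _ _ _ w xe.
    by rewrite -fi -compmorA iw.
  by exists v; rewrite -compmorA xv iw.
(* If l' < l, the two factors are exchanged: [D] becomes the top layer of [A], and the kernel [B] of
   [f] is an extension of Delta_l by [A''], to which the induction hypothesis applies. *)
have [ltl|gel] := ltnP l' l.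
  have [_ /(_ _ _ f) [B [c hc]] _ _ _] := abC.
  have epif : is_epi f by apply: (@epi_compl _ _ _ _ _ f i); rewrite fi.
  have cf := epi_kernel abC epif hc.
  have [|a ca] := @short_exact_lift _ _ _ _ _ _ _ _ (i \oc x) cf.
    by rewrite compmorA fi.
  apply: (layered_step bl' _ cf sumD); apply: (IH B l a (g \oc c)) => //.
  apply: short_exact_by_projectives => //.
  - by apply: (@mono_compr _ _ _ _ _ c); rewrite ca.
  - apply: epi_by_projectives => // Q y projQ.
    (* Lift [y] along [g] to [z], then correct [z] by an element of [A'] so that [f] kills it; [g]
       does not see the correction. *)
    have [z gz] := projQ _ _ g y epig; have [w ew] := projQ _ _ e (f \oc z) epie.
    have [|v cv] := @short_exact_lift _ _ _ _ _ _ _ _ (z - i \oc w) cf.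
      by rewrite compBr compmorA fi ew subrr.
    by exists v; rewrite -compmorA cv compBr compmorA gi0 comp0l subr0.
  - by rewrite -compmorA ca compmorA gi0 comp0l.
  - move=> Q y _ gcy; have [||v ixv] := ker_fg _ (c \oc y).
    + by rewrite compmorA (short_exact_comp0 cf) comp0l.
    + by rewrite compmorA.
    + by exists v; apply: (short_exact_mono cf); rewrite compmorA ca.
(* If l = l', the map (f, g) from [A] onto the biproduct of [D] and Delta_l has kernel [A''], so the
   top layer gains one copy. *)
have eql : l = l' by apply/val_inj/eqP; rewrite eqn_leq gel lel.
move: g ig epig gi0 ker_fg; rewrite eql => g ig epig gi0 ker_fg.
have [E [i1 [i2 [p1 [p2 [h11 h22 h21 h12 hs]]]]]] :=
  binary_biproduct abC D (Delta l').
apply: (layered_step (A' := A'') (f := i \oc x) (g := i1 \oc f + i2 \oc g) _ lay'' _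
  (direct_sum_const_rcons h11 h22 h21 h12 hs sumD)) => //.
have p1s : p1 \oc (i1 \oc f + i2 \oc g) = f.
  by rewrite compDr !compmorA h11 h12 comp0l addr0 compmor_idl.
have p2s : p2 \oc (i1 \oc f + i2 \oc g) = g.
  by rewrite compDr !compmorA h21 h22 comp0l add0r compmor_idl.
apply: short_exact_by_projectives => //.
- apply: epi_by_projectives => // Q y projQ.
  have [z gz] := projQ _ _ g (p2 \oc y) epig.
  have [w ew] := projQ _ _ e (p1 \oc y - f \oc z) epie.
  exists (z + i \oc w).
  have fy : f \oc (z + i \oc w) = p1 \oc y.
    by rewrite compDr (compmorA f) fi ew addrC subrK.
  have gy : g \oc (z + i \oc w) = p2 \oc y.
    by rewrite compDr (compmorA g) gi0 comp0l addr0.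
  by rewrite compDl -!compmorA fy gy !compmorA -compDl hs compmor_idl.
- rewrite compDl -!compmorA (compmorA f) (compmorA g) fi gi0.
  by rewrite ex0 comp0l !comp0r addr0.
- move=> Q y _ sy; apply: ker_fg.
    by rewrite -p1s -compmorA sy comp0r.
  by rewrite -p2s -compmorA sy comp0r.
Qed.

Lemma Filt_ge_layered i A : Filt_ge Delta i A -> layered i A.
Proof.
case=> s [fA]; elim: A s / fA => [A zA _|A' A F s f g _ IH fg].
  exact: layered_zero.
move=> /Forall_rcons[/IH lay [_ [[j ij ->] [h isoh]]]].
exact: layered_insert lay (short_exact_iso_quo isoh fg) ij.
Qed.

Let finHom := Deligne_Hom_finite.

(** * Weighted composition lengths *)

Section Multiplicities.
Variable w : 'I_n -> nat.

(* The multiplicity of S_i in X is dim Hom(P_i, X). *)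
Definition weight X := (\sum_(i < n) w i * vdim (mor (P i) X))%N.

Lemma weight_short_exact A B D (f : mor A B) (g : mor B D) :
  short_exact f g -> weight B = (weight A + weight D)%N.
Proof.
move=> fg; rewrite /weight -big_split /=; apply: eq_bigr => i _.
by rewrite -mulnDr (vdim_hom_short_exact finHom (@cover_projective i) fg).
Qed.

Lemma vdim_eq0 Q X : (forall f : mor Q X, f = 0) -> vdim (mor Q X) = 0%N.
Proof.
move=> h; apply/eqP; rewrite -leqn0 leqNgt; apply/negP.
by move=> /(vdim_gt0 (finHom Q X))[f]; rewrite (h f).
Qed.

Lemma weight_zero X : is_zero X -> weight X = 0%N.
Proof.
move=> zX; rewrite /weight big1 // => i _.
by rewrite vdim_eq0 ?muln0 // => f; apply: (proj1 zX).
Qed.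

Lemma weight_iso X Y (f : mor X Y) : is_iso f -> weight Y = weight X.
Proof.
move=> isof.
have [/(_ 0%N (fun=> X))[Z0 /direct_sum0_zero zZ] _ _ _ _] := abC.
by rewrite (weight_short_exact (short_exact_iso isof zZ)) (weight_zero zZ) addn0.
Qed.

Lemma weight_gt0 X : (forall i, 0 < w i)%N -> ~ is_zero X -> (0 < weight X)%N.
Proof.
move=> w0 /nonzero_cover_hom[i [f f0]].
rewrite /weight (bigD1 i) //= ltn_addr // muln_gt0 w0 /=.
by apply/(vdim_gt0 (finHom (P i) X)); exists f.
Qed.

End Multiplicities.

(** * Slopes of the standard objects and their subobjects *)

Section StabilityFunction.
Variable b : nat.
Hypothesis len_std : forall i, (weight (fun=> 1%N) (Delta i) < b)%N.
Hypothesis end_std : forall i, End_is_scalar (Delta i).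

Let len := weight (fun=> 1%N).
(** The phase of -wt + sqrt(-1) len grows with the slope wt / len. Slope inequalities are
    cross-multiplied below, which keeps them meaningful for zero objects. *)
Let wt := weight (fun i => b ^ i)%N.

Let b_gt0 i : (0 < b)%N. Proof. exact: leq_ltn_trans (len_std i). Qed.

Lemma std_endo_scalar i (f : mor (Delta i) (Delta i)) :
  exists c : k, f = c *: idmor _.
Proof.
have [phi [/bij_inj phiI phi1 _]] := end_std i; exists (phi f); apply: phiI.
by rewrite linearZ /= phi1 /GRing.scale /= mulr1.
Qed.

(** Every map from [P i] to [Delta i] is [q i] followed by an endomorphism, hence a scalar multiple
    of [q i]. *)
Lemma cover_std_epi i (g : mor (P i) (Delta i)) : g <> 0 -> is_epi g.
Proof.
have [h <-] := std_hom_factor g (@std_supported i).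
have [c ->] := std_endo_scalar h; rewrite compZl compmor_idl => cq0.
have c0 : c != 0 by apply/eqP => c0; apply: cq0; rewrite c0 scale0r.
move=> X u v; rewrite !compZr => /(scalerI c0); exact: std_epi.
Qed.

(** All factors of [X] are S_i with i < j, so b wt(X) <= b^j len(X); moreover len(Delta_j) < b, and
    b^j <= wt(Delta_j) because S_j occurs in Delta_j. *)
Lemma wt_lt j X : ~ is_zero X ->
  (forall i, (j <= i)%N -> forall f : mor (P i) X, f = 0) ->
  (wt X * len (Delta j) < wt (Delta j) * len X)%N.
Proof.
move=> nzX hX.
have lenX : (0 < len X)%N by apply: weight_gt0.
have wtX : (0 < wt X)%N by apply: weight_gt0 => // i; rewrite expn_gt0 (b_gt0 i).
have step1 : (wt X * b <= b ^ j * len X)%N.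
  rewrite /wt /len /weight big_distrl big_distrr /=; apply: leq_sum => i _.
  have [ji|ij] := leqP j i; first by rewrite vdim_eq0 ?muln0 //; apply: hX.
  rewrite mul1n mulnAC leq_mul2r -expnSr leq_pexp2l ?orbT ?(b_gt0 i) //.
have step2 : (b ^ j <= wt (Delta j))%N.
  rewrite /wt /weight (bigD1 j) //= -[leqLHS]muln1 (leq_trans _ (leq_addr _ _)) //.
  rewrite leq_mul2l; apply/orP; right.
  by apply/(vdim_gt0 (finHom _ _)); exists (q j); exact: std_map_nonzero.
apply: leq_trans (leq_mul step2 (leqnn _)); apply: leq_trans step1.
by rewrite ltn_pmul2l.
Qed.

(** S_i is no factor of a proper subobject: a nonzero map from [P i] to [X] would compose with [m]
    to an epi, making [m] an isomorphism. *)
Lemma std_sub_lt i X (m : mor X (Delta i)) :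
  is_mono m -> ~ is_zero X -> ~ is_iso m ->
  (wt X * len (Delta i) < wt (Delta i) * len X)%N.
Proof.
move=> mm nzX nim; apply: wt_lt => // j.
rewrite leq_eqVlt => /orP[/eqP/val_inj <-|ij] f.
  apply: contrapT => f0; apply: nim; apply: mono_epi_iso => //.
  apply: (@epi_compl _ _ _ _ _ m f); apply: cover_std_epi => mf0.
  by apply: f0; move/is_monoP: mm; apply.
by apply: (supported_mono mm (@std_supported i)).
Qed.

Lemma std_wt_lt i j : (i < j)%N ->
  (wt (Delta i) * len (Delta j) < wt (Delta j) * len (Delta i))%N.
Proof.
move=> ij; apply: wt_lt => [|l jl f]; first exact: std_nonzero.
by apply: (@std_supported i); exact: leq_trans jl.
Qed.

(** With equality of the slopes of [D] and Delta_j this gives semistability of a nonzero [D]. Zero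
    and improper subobjects are included so that the bound passes to extensions. *)
Definition slope_bounded j D := forall X (m : mor X D), is_mono m ->
  (wt X * len (Delta j) <= wt (Delta j) * len X)%N.

Lemma slope_bounded_zero j D : is_zero D -> slope_bounded j D.
Proof.
move=> zD X m mm; have zX := mono_zero mm zD.
by rewrite /wt /len !(weight_zero _ zX) muln0.
Qed.

Lemma slope_bounded_std j : slope_bounded j (Delta j).
Proof.
move=> X m mm; have [zX|nzX] := EM (is_zero X).
  by rewrite /wt /len !(weight_zero _ zX) muln0.
have [isom|nim] := EM (is_iso m); last exact: ltnW (std_sub_lt mm nzX nim).
by rewrite /wt /len !(weight_iso _ isom).
Qed.

(** [X] is an extension of its image in [D] by a subobject of [A], and the two bounds add up. *)
Lemma slope_bounded_ext j A B D (f : mor A B) (g : mor B D) :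
  short_exact f g -> slope_bounded j A -> slope_bounded j D -> slope_bounded j B.
Proof.
move=> fg bA bD X m mm.
have [I [e [m2 [ee mm2 gm]]]] := image_factorization abC (g \oc m).
have [K [c ce]] := epi_short_exact abC ee.
have [|a fa] := @short_exact_lift _ _ _ _ _ _ _ _ (m \oc c) fg.
  by rewrite compmorA gm -compmorA (short_exact_comp0 ce) comp0r.
have ma : is_mono a.
  apply: (@mono_compr _ _ _ _ _ f); rewrite fa.
  by apply: mono_comp => //; apply: short_exact_mono ce.
rewrite /wt /len !(weight_short_exact _ ce) mulnDl mulnDr.
exact: leq_add (bA _ _ ma) (bD _ _ mm2).
Qed.

Lemma std_filtered_slope j D s :
  filtered D s -> List.Forall (fun F => F = Delta j) s ->
  slope_bounded j D /\ (wt D * len (Delta j) = wt (Delta j) * len D)%N.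
Proof.
elim=> {D s} [A zA _|A' A F s f g _ IH fg /Forall_rcons[/IH[bA' eA'] eF]].
  by split; [exact: slope_bounded_zero | rewrite /wt /len !(weight_zero _ zA) muln0].
rewrite {}eF in g fg *; split.
  by apply: slope_bounded_ext fg bA' _; apply: slope_bounded_std.
by rewrite /wt /len !(weight_short_exact _ fg) mulnDl mulnDr -eA'.
Qed.

Lemma std_sum_slope j m D :
  is_direct_sum (fun _ : 'I_m => Delta j) D ->
  slope_bounded j D /\ (wt D * len (Delta j) = wt (Delta j) * len D)%N.
Proof.
move=> /(direct_sum_filtered abC)[s [fD sD]]; apply: std_filtered_slope fD _.
by apply: List.Forall_impl sD => F [].
Qed.

(** * The central charge and its Harder-Narasimhan filtrations *)

Section CentralCharge.
Context {R : realType}.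

Definition charge X : R[i] := (- (wt X)%:R +i* (len X)%:R)%C.

Lemma charge_short_exact A B D (f : mor A B) (g : mor B D) :
  short_exact f g -> charge B = charge A + charge D.
Proof.
by move=> fg; rewrite /charge /wt /len !(weight_short_exact _ fg) !natrD opprD.
Qed.

Lemma charge_half_plane X : ~ is_zero X -> half_plane (charge X).
Proof. by move=> nzX; apply: half_plane_Im_gt0; rewrite ltr0n weight_gt0. Qed.

Variable Z : {additive K0 C -> R[i]}.
Hypothesis ZE : forall X, Z (K0_class X) = charge X.

(** [cross] of the two charges is wt(X) len(Y) - wt(Y) len(X). *)
Lemma charge_phase_lt X Y : ~ is_zero X -> ~ is_zero Y ->
  (phase Z X < phase Z Y) = (wt X * len Y < wt Y * len X)%N.
Proof.
move=> nzX nzY; rewrite /phase !ZE cphase_lt; try exact: charge_half_plane.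
rewrite /cross /charge /= -(ltr_nat R) !natrM mulrN mulNr opprK addrC.
by rewrite subr_lt0 (mulrC (len X)%:R).
Qed.

Lemma charge_phase_le X Y : ~ is_zero X -> ~ is_zero Y ->
  (phase Z X <= phase Z Y) = (wt X * len Y <= wt Y * len X)%N.
Proof. by move=> nzX nzY; rewrite leNgt charge_phase_lt // -leqNgt. Qed.

Lemma charge_std_stable i : stable Z (Delta i).
Proof.
split=> [|X m mm nzX nim]; first exact: std_nonzero.
by rewrite charge_phase_lt //; [exact: (std_sub_lt mm) | exact: std_nonzero].
Qed.

Lemma charge_std_sum_semistable j m D :
  is_direct_sum (fun _ : 'I_m.+1 => Delta j) D -> semistable Z D.
Proof.
move=> sumD; have nzD := direct_sum_nonzero sumD (@std_nonzero j).
have [bD eD] := std_sum_slope sumD; split=> // X u mu nzX _.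
have lenj : (0 < len (Delta j))%N by apply: weight_gt0 => //; exact: std_nonzero.
(* Multiplying by len(Delta_j) > 0 lets the slope of [D] be exchanged for that of Delta_j. *)
rewrite charge_phase_le // -(leq_pmul2l lenj) mulnA (mulnC (len _)).
apply: leq_trans (leq_mul (bD _ _ mu) (leqnn _)) _.
by rewrite mulnAC -eD mulnCA mulnA.
Qed.

Lemma charge_std_sum_phase j m D :
  is_direct_sum (fun _ : 'I_m.+1 => Delta j) D -> phase Z D = phase Z (Delta j).
Proof.
move=> sumD; have nzD := direct_sum_nonzero sumD (@std_nonzero j).
have nzj := @std_nonzero j; have [_ eD] := std_sum_slope sumD.
by apply/le_anti; rewrite !charge_phase_le // eD !leqnn.
Qed.

(** The layers are semistable with the phases of the Delta_l, and l strictly decreases from bottom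
    to top, so the layered filtration is already the Harder-Narasimhan filtration. *)
Lemma layered_HN (c : nat) A : layered c A -> exists s, HN_factors Z A s /\
  List.Forall (fun F => exists (l : 'I_n) m,
    (c <= l)%N /\ is_direct_sum (fun _ : 'I_m.+1 => Delta l) F) s.
Proof.
elim=> {c A} [c A zA|c l m A' A D f g cl _ [s [[fA' ssA' soA'] sA']] fg sumD].
  by exists [::]; do !split=> //; apply: filtered_nil.
exists (rcons s D); do !split.
- exact: filtered_rcons fA' fg.
- by apply/Forall_rcons; split=> //; apply: charge_std_sum_semistable sumD.
(* Transitivity makes sortedness a pairwise condition: the phase of the new top layer is compared
   with every earlier one. *)
- have tr : transitive (fun x y : R => y < x).
    by move=> x y z yx zy; apply: lt_trans zy yx.
  rewrite map_rcons sorted_pairwise // pairwise_rcons -sorted_pairwise //.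
  rewrite soA' andbT.
  rewrite all_map; apply: Forall_all.
  apply: List.Forall_impl sA' => F [l' [m' [ll' sumF]]].
  rewrite /= (charge_std_sum_phase sumD) (charge_std_sum_phase sumF).
  rewrite charge_phase_lt; try exact: std_nonzero.
  exact: std_wt_lt.
- apply/Forall_rcons; split; last by exists l, m.
  apply: List.Forall_impl sA' => F [l' [m' [ll' sumF]]]; exists l', m'; split=> //.
  exact: leq_trans cl (ltnW ll').
Qed.

End CentralCharge.
End StabilityFunction.

Lemma highest_weight_stability (R : realType) : highest_weight P Delta ->
  exists Z : {additive K0 C -> R[i]},
    [/\ is_stability Z,
        (forall i, stable Z (Delta i)) /\
        (forall i j : 'I_n, (i < j)%N -> phase Z (Delta i) < phase Z (Delta j))
      & forall i, exists2 s, HN_factors Z (P i) s &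
          List.Forall (sum_of_ge Delta i) s].
Proof.
move=> hw; have endD i := proj1 (hw i).
(* The sum dominates each length, and the successor makes the bound strict. *)
pose b := (\sum_(i < n) weight (fun=> 1%N) (Delta i)).+1.
have len_std i : (weight (fun=> 1%N) (Delta i) < b)%N.
  by rewrite ltnS (bigD1 i) //= leq_addr.
have [Z ZE] := K0_universal (@charge_short_exact b R).
exists Z; split=> [X nzX|| i].
- by rewrite ZE; exact: charge_half_plane.
- split=> [i|i j ij]; first exact: charge_std_stable.
  rewrite (charge_phase_lt ZE); try exact: std_nonzero.
  exact: std_wt_lt.
- have [s [HNs sums]] := layered_HN len_std endD ZE (Filt_ge_layered (proj2 (hw i))).
  exists s => //; apply: List.Forall_impl sums => F [l [m [il sumF]]].
  by exists m.+1, (fun=> l).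
Qed.

End Standard.

(** * Stable objects *)

Section Schur.
Context {k : closedFieldType} {C : linCategory k} (abC : is_abelian C).
Implicit Types A X : C.

(** Composition with [f] has an eigenvalue c on the nonzero finite-dimensional space End(X), as [k]
    is algebraically closed. An eigenvector [g] is nonzero and killed by f - c, so f - c is not mono
    and must vanish. *)
Lemma endo_scalar X : finite_dim (mor X X) -> ~ is_zero X ->
  (forall f : mor X X, f <> 0 -> is_mono f) ->
  forall f : mor X X, exists c : k, f = c *: idmor X.
Proof.
move=> finX nzX monoX f; have [b [bV bI]] := vdim_basis finX.
have m0 : (0 < vdim (mor X X))%N.
  by apply/(vdim_gt0 finX); exists (idmor X) => id0; apply/nzX/is_zeroP.
move: (vdim (mor X X)) m0 b bV bI => m m0 b bV bI.
have /fin_all_exists[a fb] i := bV (f \oc b i).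
(* Row [i] holds the coordinates of [f \oc b i]; a left eigenvector of [M] thus lists the
   coordinates of [g]. *)
pose M := \matrix_(i < m, j < m) a i j.
have /closed_rootP[c] : size (char_poly M) != 1%N.
  by rewrite size_char_poly eqSS -lt0n.
rewrite -eigenvalue_root_char => /eigenvalueP[v vM v0].
pose g := \sum_i v 0 i *: b i.
have fg : f \oc g = c *: g.
  rewrite comp_sumr scaler_sumr.
  under eq_bigr => i _ do rewrite compZr fb scaler_sumr.
  rewrite exchange_big; apply: eq_bigr => j _ /=.
  rewrite scalerA; have -> : c * v 0 j = (v *m M) 0 j by rewrite vM mxE.
  rewrite mxE scaler_suml; apply: eq_bigr => i _.
  by rewrite scalerA mxE.
exists c; apply: contrapT => fc.
have /is_monoP/(_ _ g) fcmono : is_mono (f - c *: idmor X).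
  by apply: monoX => /eqP; rewrite subr_eq0 => /eqP.
have g0 : g = 0 by apply: fcmono; rewrite compBl compZl compmor_idl fg subrr.
move/eqP: v0; apply; apply/rowP => i; rewrite mxE.
exact: (bI (v 0) g0).
Qed.

(** Since the identity of [X] is nonzero, the scalar of an endomorphism is unique; this makes the
    chosen scalars linear and multiplicative. *)
Lemma End_is_scalar_of_scalar_endos X : ~ is_zero X ->
  (forall f : mor X X, exists c : k, f = c *: idmor X) -> End_is_scalar X.
Proof.
move=> nzX scal; pose phi (f : mor X X) : k^o := sval (cid (scal f)).
have phiP f : phi f *: idmor X = f by rewrite /phi; case: cid => c /= <-.
have scalI : injective (fun c : k => c *: idmor X).
  move=> c d /eqP; rewrite -subr_eq0 -scalerBl scaler_eq0 subr_eq0.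
  by case/orP => [/eqP //|/eqP id0]; case: nzX; apply/is_zeroP.
have phi_linear : linear phi.
  by move=> a f g; apply: scalI; rewrite /= phiP scalerDl -scalerA !phiP.
pose Phi : {linear mor X X -> k^o} :=
  HB.pack phi (GRing.isLinear.Build _ _ _ _ phi phi_linear).
exists Phi; split=> [||f g].
- by exists (fun c => c *: idmor X) => [f|c]; [exact: phiP | exact/scalI/phiP].
- by apply: scalI; rewrite /= phiP scale1r.
- apply: scalI; rewrite /= phiP -scalerA (phiP f).
  by rewrite -[in LHS](phiP g) compZl compmor_idl.
Qed.

Lemma K0_class_zero A : is_zero A -> K0_class A = 0.
Proof.
move=> zA; have := K0_class_short_exact (short_exact_zero_id (idmor A) zA).
by rewrite -[X in X = _]addr0 => /addrI.
Qed.

Lemma K0_class_iso A X (f : mor A X) : is_iso f -> K0_class A = K0_class X.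
Proof.
move=> isof; have [/(_ 0%N (fun=> X))[D /direct_sum0_zero zD] _ _ _ _] := abC.
rewrite (K0_class_short_exact (short_exact_iso isof zD)).
by rewrite (K0_class_zero zD) addr0.
Qed.

Context {R : realType} (Z : {additive K0 C -> R[i]}).

(** If the kernel [K] were nonzero, its phase would be below that of [X], while the image [I], also
    a subobject of [X], has phase at most that of [X]. This contradicts Z(X) = Z(K) + Z(I), because
    [cross] against Z(X) is additive and vanishes at Z(X). *)
Lemma stable_endo_mono X (f : mor X X) :
  is_stability Z -> stable Z X -> f <> 0 -> is_mono f.
Proof.
move=> stabZ [nzX stX] f0.
have [I [e [m [ee mm fE]]]] := image_factorization abC f.
have [K [c ce]] := epi_short_exact abC ee.
have [zK|nzK] := EM (is_zero K).
  by rewrite fE; apply: mono_comp => //; apply: mono_kernel0 (proj1 ce) zK.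
have e0 : e <> 0 by move=> e0; apply: f0; rewrite fE e0 comp0r.
have nzI : ~ is_zero I by move=> [/(_ _ e)].
have ltK : phase Z K < phase Z X.
  apply: (stX _ c) => //; first exact: short_exact_mono ce.
  by move=> /iso_epi/is_epiP ec; apply/e0/ec/short_exact_comp0.
have leI : phase Z I <= phase Z X.
  have [/K0_class_iso eI|nim] := EM (is_iso m); first by rewrite /phase eI.
  by apply/ltW/(stX _ m).
move: ltK leI; rewrite /phase cphase_lt ?cphase_le; try exact: stabZ.
have ZX : Z (K0_class X) = Z (K0_class K) + Z (K0_class I).
  by rewrite (K0_class_short_exact ce) raddfD.
have : cross (Z (K0_class X)) (Z (K0_class X)) = 0 by rewrite /cross; ring.
rewrite {1}ZX crossDl; lra.
Qed.

End Schur.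

(** Each direct sum is refined into its summands, and the pieces are concatenated along the
    filtration. *)
Lemma sum_of_ge_filtered (k : fieldType) (C : linCategory k)
    (finC : Deligne_finite C) n (Delta : 'I_n -> C) (i : 'I_n) (A : C) s :
  filtered A s -> List.Forall (sum_of_ge Delta i) s -> Filt_ge Delta i A.
Proof.
have abC := Deligne_abelian finC; have projC := Deligne_enough_projectives finC.
elim=> {A s} [A zA _|A' A F s f g _ IH fg].
  by exists [::]; split=> //; apply: filtered_nil.
move=> /Forall_rcons[/IH[t [fA' tA']] [m [J [iJ]]]].
move=> /(direct_sum_filtered abC)[u [fF uF]].
exists (t ++ u); split; first exact: (filtered_cat abC projC fA' fF fg).
apply/Forall_cat; split=> //; apply: List.Forall_impl uF => G [l ->].
by exists (Delta (J l)); split; [exists (J l) | apply: isomorphic_refl].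
Qed.

Theorem theorem2 (R : realType) (k : closedFieldType) (A : linCategory k)
  (finA : Deligne_finite A)
  (n : nat) (S : 'I_n -> A) (ordS : simple_ordering S)
  (P : 'I_n -> A) (p : forall i, mor (P i) (S i))
  (coverP : forall i, is_projective_cover (p i))
  (Delta : 'I_n -> A) (q : forall i, mor (P i) (Delta i))
  (stdDelta : forall i, is_max_quotient (Filt_le S i) (q i)) :
  highest_weight P Delta <->
  exists Z : {additive K0 A -> R[i]},
    [/\ is_stability Z,
        (forall i, stable Z (Delta i)) /\
        (forall i j : 'I_n, (i < j)%N ->
           phase Z (Delta i) < phase Z (Delta j))
      & forall i, exists2 s, HN_factors Z (P i) s &
          List.Forall (sum_of_ge Delta i) s].
Proof.
split=> [|[Z [stabZ [stD _] HN]] i].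
  exact: (highest_weight_stability finA ordS coverP stdDelta).
split; last first.
  by have [s [fP _ _] sP] := HN i; apply: (sum_of_ge_filtered finA fP sP).
have nzD : ~ is_zero (Delta i) by case: (stD i).
apply: End_is_scalar_of_scalar_endos => //; apply: endo_scalar => //.
  exact: Deligne_Hom_finite.
by move=> f; apply: stable_endo_mono (stD i); first exact: Deligne_abelian.
Qed.
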